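(* Let $q=p^n$ with $p$ prime and $n\ge 1$. For a nontrivial element $\sigma\in\mathrm{PGU}(3,q)$, one of the following cases holds. \begin{itemize} \item[(A)] $\mathrm{ord}(\sigma)\mid(q+1)$. Moreover, $\sigma$ is a homology whose center $P$ is a point off $\mathcal H_q$ and whose axis $\ell$ is a chord of $\mathcal H_q(\mathbb F_{q^2})$ such that $(P,\ell)$ is a pole-polar pair with respect to the unitary polarity associated to $\mathcal H_q(\mathbb F_{q^2})$. \item[(B)] $\mathrm{ord}(\sigma)$ is coprime with $p$. Moreover, $\sigma$ fixes the vertices $P_1,P_2,P_3$ of a non-degenerate triangle $T$, and one of the following holds: \begin{itemize} \item[(B1)] The points $P_1,P_2,P_3$ are $\mathbb F_{q^2}$-rational, $P_1,P_2,P_3\notin\mathcal H_q$, and the triangle $T$ is self-polar with respect to the unitary polarity associated to $\mathcal H_q(\mathbb F_{q^2})$. Also, $\mathrm{ord}(\sigma)\mid(q+1)$. \item[(B2)] The points $P_1,P_2,P_3$ are $\mathbb F_{q^2}$-rational, $P_1\notin\mathcal H_q$, $P_2,P_3\in\mathcal H_q$. Also, $\mathrm{ord}(\sigma)\mid(q^2-1)$ and $\mathrm{ord}(\sigma)\nmid(q+1)$. \item[(B3)] The points $P_1,P_2,P_3$ have coordinates in $\mathbb F_{q^6}\setminus\mathbb F_{q^2}$, and $P_1,P_2,P_3\in\mathcal H_q$. Also, $\mathrm{ord}(\sigma)\mid(q^2-q+1)$. \end{itemize} \item[(C)] $\mathrm{ord}(\sigma)=p$. Moreover, $\sigma$ is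 an elation whose center $P$ is a point of $\mathcal H_q$ and whose axis $\ell$ is a tangent of $\mathcal H_q(\mathbb F_{q^2})$ such that $(P,\ell)$ is a pole-polar pair with respect to the unitary polarity associated to $\mathcal H_q(\mathbb F_{q^2})$. \item[(D)] $\mathrm{ord}(\sigma)=p$ with $p\ne 2$, or $\mathrm{ord}(\sigma)=4$ and $p=2$. Moreover, $\sigma$ fixes an $\mathbb F_{q^2}$-rational point $P$, with $P\in\mathcal H_q$, and a line $\ell$ which is a tangent of $\mathcal H_q(\mathbb F_{q^2})$, such that $(P,\ell)$ is a pole-polar pair with respect to the unitary polarity associated to $\mathcal H_q(\mathbb F_{q^2})$. \item[(E)] $p\mid\mathrm{ord}(\sigma)$, $p^2\nmid\mathrm{ord}(\sigma)$, and $\mathrm{ord}(\sigma)\ne p$. Moreover, $\sigma$ fixes two $\mathbb F_{q^2}$-rational points $P,Q$, with $P\in\mathcal H_q$, $Q\notin\mathcal H_q$. \end{itemize}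
   Context: $\mathcal H_q$ is the Hermitian curve, the non-singular plane curve $X^{q+1}+Y^{q+1}+T^{q+1}=0$, considered up to projective equivalence over $\mathbb F_{q^2}$ (another model is $Y^{q+1}=X^qT+XT^q$). $\mathrm{PGU}(3,q)\le\mathrm{PGL}(3,q^2)$ is the group of linear collineations over $\mathbb F_{q^2}$ preserving $\mathcal H_q$; it acts on $\mathrm{PG}(2,\overline{\mathbb F}_q)$. The set $\mathcal H_q(\mathbb F_{q^2})$ of $\mathbb F_{q^2}$-rational points has size $q^3+1$ and it is the set of isotropic points of a unitary polarity of $\mathrm{PG}(2,q^2)$; each line of $\mathrm{PG}(2,q^2)$ meets $\mathcal H_q(\mathbb F_{q^2})$ in $1$ point (such a line is the tangent to $\mathcal H_q$ at that point, and these are exactly the isotropic lines) or in $q+1$ points (such a line is a chord). A triangle is self-polar if each side is the polar line of the opposite vertex. ''Points with coordinates in $\mathbb F_{q^6}\setminus\mathbb F_{q^2}$'' means points of $\mathrm{PG}(2,q^6)\setminus\mathrm{PG}(2,q^2)$. A linear collineation $\sigma$ is a $(P,\ell)$-perspectivity if it preserves each line through the point $P$ (the center) and fixes each point on the line $\ell$ (the axis); it is an elation if $P\in\ell$ and a homology if $P\notin\ell$. *)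

(* Defs.v *)
From HB Require Import structures.
From mathcomp Require Import all_boot all_order all_fingroup all_algebra.
From mathcomp Require Import all_solvable all_field.

Set Implicit Arguments.
Unset Strict Implicit.
Unset Printing Implicit Defensive.

Import GRing.Theory.
Local Open Scope ring_scope.

(* Subspaces of K^3 (row vectors) are the points (dimension 1) and the lines  *)
(* (dimension 2) of PG(2, K); incidence is inclusion of subspaces.            *)
Section ProjectivePlane.

Variable K : fieldType.
Implicit Types P l : {vspace 'rV[K]_3}.

Definition is_point P : Prop := \dim P = 1%N.

Definition is_line l : Prop := \dim l = 2%N.

Definition non_degenerate_triangle P1 P2 P3 : Prop :=
  [/\ is_point P1, is_point P2, is_point P3 & (P1 + P2 + P3)%VS = fullv].

(* When m is a power of the characteristic and K is algebraically closed,     *)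
(* {x | x ^+ m = x} is the subfield of order m of K, and the points and lines *)
(* defined over it are those of PG(2, m).                                     *)
Definition defined_over (m : nat) (V : {vspace 'rV[K]_3}) : Prop :=
  exists2 X : seq 'rV[K]_3,
    forall v, v \in X -> forall j, v 0 j ^+ m = v 0 j & V = <<X>>%VS.

Definition PG2_point (m : nat) P : Prop := is_point P /\ defined_over m P.

Definition PG2_line (m : nat) l : Prop := is_line l /\ defined_over m l.

End ProjectivePlane.

Definition PGL3 (F : finFieldType) := coset_of 'Z('GL_3[F])%g.

Section Collineations.

Variables (F : finFieldType) (K : fieldType) (iota : {rmorphism F -> K}).
Implicit Types (sigma : PGL3 F) (P l : {vspace 'rV[K]_3}).

(* The choice of a representative matrix of sigma is immaterial, since two    *)
(* representatives differ by a scalar matrix.                                 *)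
Definition collineation_mx sigma : 'M[F]_3 := GLval (repr sigma).

Definition collineation sigma (V : {vspace 'rV[K]_3}) : {vspace 'rV[K]_3} :=
  (linfun (mulmxr (map_mx iota (collineation_mx sigma))) @: V)%VS.

Definition perspectivity sigma P l : Prop :=
  [/\ is_point P, is_line l,
      forall m, is_line m -> (P <= m)%VS -> collineation sigma m = m
    & forall Q, is_point Q -> (Q <= l)%VS -> collineation sigma Q = Q].

Definition elation sigma P l : Prop := perspectivity sigma P l /\ (P <= l)%VS.

Definition homology sigma P l : Prop :=
  perspectivity sigma P l /\ ~~ (P <= l)%VS.

End Collineations.

(* An invertible matrix M over F = F_{q^2} selects a model of the Hermitian   *)
(* curve in its class of projective equivalence over F: the curve with        *)
(* equation X^(q+1) + Y^(q+1) + T^(q+1) = 0 in the coordinates                *)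
(* (X, Y, T) = v M. The Fermat model itself is M = 1.                         *)
Section HermitianCurve.

Variables (F : finFieldType) (K : fieldType) (iota : {rmorphism F -> K}).
Variables (q : nat) (M : {'GL_3[F]}).
Implicit Types (P l : {vspace 'rV[K]_3}) (u v : 'rV[K]_3).

Definition model_coord v : 'rV[K]_3 := v *m map_mx iota (GLval M).

Definition hermitian_eq v : K := \sum_(i < 3) model_coord v 0 i ^+ q.+1.

Definition on_hermitian P : Prop :=
  is_point P /\ forall v, v \in P -> hermitian_eq v = 0.

Definition hermitian_form u v : K :=
  \sum_(i < 3) model_coord u 0 i * model_coord v 0 i ^+ q.

(* (P, l) is a pole-polar pair for the unitary polarity of PG(2, q^2) whose   *)
(* isotropic points are the F_{q^2}-rational points of the curve.             *)
Definition pole_polar P l : Prop :=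
  [/\ PG2_point (q ^ 2) P, PG2_line (q ^ 2) l
    & forall u v, v \in P -> v != 0 -> (u \in l) = (hermitian_form u v == 0)].

Definition self_polar_triangle P1 P2 P3 : Prop :=
  [/\ pole_polar P1 (P2 + P3)%VS, pole_polar P2 (P1 + P3)%VS
    & pole_polar P3 (P1 + P2)%VS].

Definition meets_hermitian_in (k : nat) l : Prop :=
  exists s : seq {vspace 'rV[K]_3},
    [/\ uniq s, size s = k
      & forall P, P \in s <->
          [/\ PG2_point (q ^ 2) P, on_hermitian P & (P <= l)%VS]].

Definition tangent l : Prop := PG2_line (q ^ 2) l /\ meets_hermitian_in 1 l.

Definition chord l : Prop := PG2_line (q ^ 2) l /\ meets_hermitian_in q.+1 l.

Definition in_PGU3 (sigma : PGL3 F) : Prop :=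
  forall P, is_point P ->
    (on_hermitian (collineation iota sigma P) <-> on_hermitian P).

End HermitianCurve.

Section Cases.

Variables (F : finFieldType) (K : fieldType) (iota : {rmorphism F -> K}).
Variables (p q : nat) (M : {'GL_3[F]}) (sigma : PGL3 F).

Notation ord := #[sigma]%g.
Notation act := (collineation iota sigma).
Notation rational := (PG2_point (q ^ 2)).
Notation onH := (on_hermitian iota q M).

Definition case_A : Prop :=
  (ord %| q.+1)%N /\
  exists P l, [/\ homology iota sigma P l, is_point P /\ ~ onH P,
                  chord iota q M l & pole_polar iota q M P l].

Definition case_B1 (P1 P2 P3 : {vspace 'rV[K]_3}) : Prop :=
  [/\ [/\ rational P1, rational P2 & rational P3],
      [/\ ~ onH P1, ~ onH P2 & ~ onH P3],
      self_polar_triangle iota q M P1 P2 P3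
    & (ord %| q.+1)%N].

Definition case_B2 (P1 P2 P3 : {vspace 'rV[K]_3}) : Prop :=
  [/\ [/\ rational P1, rational P2 & rational P3],
      [/\ ~ onH P1, onH P2 & onH P3],
      (ord %| q ^ 2 - 1)%N
    & ~~ (ord %| q.+1)%N].

Definition case_B3 (P1 P2 P3 : {vspace 'rV[K]_3}) : Prop :=
  [/\ [/\ PG2_point (q ^ 6) P1, PG2_point (q ^ 6) P2 & PG2_point (q ^ 6) P3],
      [/\ ~ rational P1, ~ rational P2 & ~ rational P3],
      [/\ onH P1, onH P2 & onH P3]
    & (ord %| q ^ 2 - q + 1)%N].

Definition case_B : Prop :=
  coprime ord p /\
  exists P1 P2 P3 : {vspace 'rV[K]_3},
    [/\ non_degenerate_triangle P1 P2 P3,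
        [/\ act P1 = P1, act P2 = P2 & act P3 = P3]
      & [\/ case_B1 P1 P2 P3, case_B2 P1 P2 P3 | case_B3 P1 P2 P3]].

Definition case_C : Prop :=
  ord = p /\
  exists P l, [/\ elation iota sigma P l, onH P,
                  tangent iota q M l & pole_polar iota q M P l].

Definition case_D : Prop :=
  (ord = p /\ p <> 2%N \/ ord = 4%N /\ p = 2%N) /\
  exists P l, [/\ act P = P /\ act l = l, rational P /\ onH P,
                  tangent iota q M l & pole_polar iota q M P l].

Definition case_E : Prop :=
  [/\ (p %| ord)%N, ~~ (p ^ 2 %| ord)%N, ord <> p
    & exists P Q, [/\ act P = P, act Q = Q, rational P /\ onH P
                    & rational Q /\ ~ onH Q]].

End Cases.

(* Main.v *)
Require Import Defs.
From HB Require Import structures.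
From mathcomp Require Import all_boot all_order all_fingroup all_algebra.
From mathcomp Require Import all_solvable all_field ring.

(** The collineation is induced by a matrix [A] such that
    [h (u A) (v A) = c * h u v] for the Hermitian form [h], where [c ^+ q = c]:
    this follows by looking at the points of the curve on the sides of the
    reference triangle.  Hence [a * b ^+ q = c] whenever [h u v != 0] for
    eigenvectors [u], [v] with eigenvalues [a], [b].  If some [A - a] has rank
      1,
    then its kernel is the polar line of its image and we get (A) or (C),
    according to whether the center is isotropic.  Otherwise all eigenspaces are
    points.  With three distinct eigenvalues, [a |-> c / a ^+ q] permutes them,
    and the identity, the transpositions and the 3-cycles give (B1), (B2) and
    (B3), the square of this permutation being the Frobenius map of order
    [q ^ 2].  With two distinct eigenvalues there is a Jordan block of size 2
      and
    we get (E); with a single one there is a Jordan block of size 3 and we get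
    (D).  Orders are read off from the powers of [A] that are scalar. *)

Set Implicit Arguments.
Unset Strict Implicit.
Unset Printing Implicit Defensive.

Import GRing.Theory.
Local Open Scope ring_scope.

(** * Splitting the three coordinate indices *)

Lemma ord3_others (k : 'I_3) :
  exists i j, [/\ i != k, j != k, i != j & forall m, [\/ m = i, m = j | m = k]].
Proof.
exists (lift k ord0), (lift k ord_max); split.
- by rewrite eq_sym neq_lift.
- by rewrite eq_sym neq_lift.
- by rewrite (inj_eq (@lift_inj _ k)).
move=> m; case: (unliftP k m) => [l ->|->]; last by constructor 3.
by case: (unliftP ord0 l) => [l' ->|->]; [constructor 2|constructor 1];
   congr lift; apply: val_inj; case: l' => -[].
Qed.

Lemma sum_ord3 (R : nmodType) (F : 'I_3 -> R) (i j k : 'I_3) :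
  i != k -> j != k -> i != j -> \sum_m F m = F k + F i + F j.
Proof.
move=> ik jk ij; rewrite (bigD1 k) //= (bigD1 i) //= (bigD1 j) /= ?jk 1?eq_sym
  //.
rewrite big_pred0 ?addr0 ?addrA // => m; apply/negbTE.
have: (#|[set i; j; k; m]| <= 3)%N by rewrite -[X in (_ <= X)%N](card_ord 3)
  max_card.
rewrite -!setUA !cardsU1 !inE !negb_or cards1 ij ik jk [i == m]eq_sym.
by rewrite [j == m]eq_sym [k == m]eq_sym; case: (m == k); case: (m == i); case:
  (m == j).
Qed.

(** * Points, lines and bases in a three-dimensional space *)

Section Independence.

Variable K : fieldType.
Implicit Types (u v w x : 'rV[K]_3) (V : {vspace 'rV[K]_3}).

(** Freeness is spelled out with coefficients, so that a linear relation can be multiplied by a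
    matrix or paired with a vector through the Hermitian form. *)
Definition indep2 u v : Prop :=
  forall a b : K, a *: u + b *: v = 0 -> a = 0 /\ b = 0.

Definition indep3 u v w : Prop :=
  forall a b c : K, a *: u + b *: v + c *: w = 0 -> [/\ a = 0, b = 0 & c = 0].

Lemma indep3_free u v w : indep3 u v w -> free [:: u; v; w].
Proof.
move=> iuvw; apply/(@freeP _ _ 3 [tuple u; v; w]) => k.
rewrite !big_ord_recl big_ord0 addr0 addrA => /iuvw[k0 k1 k2] i.
by case: i => [[|[|[|?]]] lti] //; [rewrite -k0|rewrite -k1|rewrite -k2];
   congr k; apply: val_inj.
Qed.

Lemma indep2_free u v : indep2 u v -> free [:: u; v].
Proof.
move=> iuv; apply/(@freeP _ _ 2 [tuple u; v]) => k.
rewrite !big_ord_recl big_ord0 addr0 => /iuv[k0 k1] i.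
by case: i => [[|[|?]] lti] //; [rewrite -k0|rewrite -k1];
   congr k; apply: val_inj.
Qed.

Lemma span2 u v : <<[:: u; v]>>%VS = (<[u]> + <[v]>)%VS.
Proof. by rewrite span_cons span_seq1. Qed.

Lemma span3 u v w : <<[:: u; v; w]>>%VS = (<[u]> + <[v]> + <[w]>)%VS.
Proof. by rewrite span_cons span2 addvA. Qed.

Lemma indep3_full u v w :
  indep3 u v w -> (<[u]> + <[v]> + <[w]>)%VS = fullv.
Proof.
move=> /indep3_free fr; rewrite -span3; apply/eqP.
by rewrite eqEdim subvf (eqP fr) dimvf.
Qed.

Lemma mem_line2 x u v :
  x \in (<[u]> + <[v]>)%VS -> exists a b, x = a *: u + b *: v.
Proof.
by case/memv_addP=> _ /vlineP[a ->] [_ /vlineP[b ->] ->]; exists a, b.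
Qed.

Lemma line2_mem a b u v : a *: u + b *: v \in (<[u]> + <[v]>)%VS.
Proof. by rewrite memv_add // memvZ // memv_line. Qed.

Lemma indep3_basis u v w x :
  indep3 u v w -> exists a b c, x = a *: u + b *: v + c *: w.
Proof.
move=> /indep3_full full; have := memvf x; rewrite -full.
case/memv_addP=> y /mem_line2[a [b ->]] [_ /vlineP[c ->] ->].
by exists a, b, c.
Qed.

Lemma is_line_span2 u v : indep2 u v -> is_line (<[u]> + <[v]>)%VS.
Proof. by move=> /indep2_free fr; rewrite /is_line -span2 (eqP fr). Qed.

Lemma is_point_line u : u != 0 -> is_point <[u]>%VS.
Proof. by rewrite /is_point dim_vline => ->. Qed.

Lemma is_pointP V : is_point V -> exists2 u, u != 0 & V = <[u]>%VS.
Proof.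
move=> dV; exists (vpick V); first by rewrite vpick0 -dimv_eq0 dV.
apply/eqP; rewrite eq_sym eqEdim -memvE memv_pick dV dim_vline.
by rewrite vpick0 -dimv_eq0 dV.
Qed.

Lemma indep2_nonzero u v : indep2 u v -> u != 0 /\ v != 0.
Proof.
move=> iuv; split; apply/eqP=> z.
  by case: (iuv 1 0) => [|/eqP]; rewrite ?z ?scaler0 ?scale0r ?addr0 ?oner_eq0.
by case: (iuv 0 1) => [|_ /eqP]; rewrite ?z ?scaler0 ?scale0r ?addr0 ?oner_eq0.
Qed.

Lemma indep2_sym u v : indep2 u v -> indep2 v u.
Proof. by move=> iuv a b; rewrite addrC => /iuv[]. Qed.

Lemma not_collinear_indep2 u v :
  u != 0 -> v \notin <[u]>%VS -> indep2 u v.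
Proof.
move=> u0 vu a b e; have [b0|b0] := eqVneq b 0.
  split=> //; move/eqP: e; rewrite b0 scale0r addr0 scaler_eq0 (negPf u0) orbF.
  by move/eqP.
case/negP: vu; apply/vlineP; exists (- (b^-1 * a)).
rewrite scaleNr -scalerA; apply/eqP; rewrite -subr_eq0 opprK.
by rewrite -[X in X + _](scalerK b0) -scalerDr addrC e scaler0.
Qed.

Lemma vline_eqZ (a : K) u : a != 0 -> <[a *: u]>%VS = <[u]>%VS.
Proof.
move=> a0; apply/eqP; rewrite eqEdim -memvE memvZ ?memv_line //.
by rewrite !dim_vline scaler_eq0 (negPf a0) leqnn.
Qed.

(* The kernel of a nonzero functional [f], with [f k != 0], is spanned by the *)
(* vectors [e_i - (f i / f k) e_k] for the two indices [i] other than [k].    *)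
Lemma functional_kernel_basis (f : 'I_3 -> K) (k : 'I_3) : f k != 0 ->
  exists a b : 'rV[K]_3,
    [/\ indep2 a b,
        forall x, \sum_i x 0 i * f i = 0 -> exists s t, x = s *: a + t *: b,
        \sum_i a 0 i * f i = 0 /\ \sum_i b 0 i * f i = 0
      & forall g : {rmorphism K -> K}, (forall i, g (f i) = f i) ->
          map_mx g a = a /\ map_mx g b = b].
Proof.
move=> fk; have [i [j [ik jk ij ijk]]] := ord3_others k.
pose e l : 'rV[K]_3 :=
  \row_m (if m == l then 1 else if m == k then - (f l / f k) else 0).
have ek l : l != k -> \sum_m e l 0 m * f m = 0.
  move=> lk; rewrite (bigD1 k) //= (bigD1 l) //= big1 => [|m].
    by rewrite !mxE eqxx eq_sym (negPf lk) eqxx mul1r addr0 mulNr divfK ?addNr.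
  by case/andP=> mk ml; rewrite !mxE (negPf ml) (negPf mk) mul0r.
exists (e i), (e j); split.
- move=> a b /rowP E.
  have := E i; rewrite !mxE eqxx (negPf ij) (negPf ik) mulr1 mulr0 addr0 => ->.
  by have := E j; rewrite !mxE eqxx eq_sym (negPf ij) (negPf jk) mulr1 mulr0
    add0r.
- move=> x; rewrite (sum_ord3 _ ik jk ij) => fx.
  exists (x 0 i), (x 0 j); apply/rowP => m; rewrite !mxE.
  case: (ijk m) => ->; rewrite ?eqxx ?[j == i]eq_sym ?(negPf ij) ?(negPf ik)
    ?(negPf jk).
  + by rewrite mulr1 mulr0 addr0.
  + by rewrite mulr1 mulr0 add0r.
  rewrite ![k == _]eq_sym (negPf ik) (negPf jk); apply: (mulIf fk).
  apply/eqP; rewrite -subr_eq0 -fx; apply/eqP; field; exact: fk.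
- by rewrite !ek.
move=> g gf; have ge l : map_mx g (e l) = e l.
  apply/rowP=> m; rewrite !mxE; case: (m == l); rewrite ?rmorph1 //.
  by case: (m == k); rewrite ?rmorph0 // rmorphN fmorph_div !gf.
by rewrite !ge.
Qed.

Lemma vector_coord_neq0 v : v != 0 -> exists j, v 0 j != 0.
Proof.
by move=> v0; apply/existsP; apply: contraNT v0 => /existsPn v0;
   apply/eqP/rowP=> j; rewrite mxE; apply/eqP; rewrite -[_ == _]negbK v0.
Qed.

Lemma exists_row_neq0 (N : 'M[K]_3) : N != 0 -> exists k, row k N != 0.
Proof.
move=> N0; apply/existsP; apply: contraR N0 => /existsPn r0.
by apply/eqP/row_matrixP => i; apply/eqP; rewrite row0 -[_ == _]negbK r0.
Qed.

(** All rows are multiples of one nonzero row, and the ratios are read off in a column where that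
    row does not vanish. For a perspectivity the row spans the center and the kernel of the
    functional is the axis. *)
Lemma rank1_decomposition (N : 'M[K]_3) : N != 0 -> (\rank N <= 1)%N ->
  exists k (j : 'I_3), N k j != 0 /\
    forall x : 'rV[K]_3, x *m N = (\sum_i x 0 i * (N i j / N k j)) *: row k N.
Proof.
move=> N0 rkN; have [k rk0] := exists_row_neq0 N0.
have [j Nkj] := vector_coord_neq0 rk0; rewrite mxE in Nkj; exists k, j; split=>
  // x.
have sub : (N <= row k N)%MS.
  by rewrite -(geq_leqif (mxrank_leqif_sup (row_sub k N))) rank_rV rk0.
have rowE i : row i N = (N i j / N k j) *: row k N.
  have /sub_rVP[a ra] := submx_trans (row_sub i N) sub.
  have: row i N 0 j = a * row k N 0 j by rewrite ra mxE.
  by rewrite !mxE => ->; rewrite mulfK.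
rewrite mulmx_sum_row scaler_suml; apply: eq_bigr => i _.
by rewrite (rowE i) scalerA.
Qed.

End Independence.

(** * Frobenius powers as ring morphisms *)

Section PowerFrobenius.

Variables (R : comNzRingType) (m : nat) (charRm : [pchar R].-nat m).

(** The phantom argument records that [m] is a power of the characteristic, so that the morphism
    structures can be attached to the function. *)
Definition power_frobenius of [pchar R].-nat m := fun x : R => x ^+ m.

Local Notation phi := (power_frobenius charRm).

Fact power_frobenius_is_zmod_morphism : zmod_morphism phi.
Proof. by move=> x y; rewrite /phi exprDn_pchar // exprNn_pchar. Qed.

Fact power_frobenius_is_monoid_morphism : monoid_morphism phi.
Proof. by split=> [|x y]; rewrite /phi ?expr1n ?exprMn. Qed.

HB.instance Definition _ :=
  GRing.isZmodMorphism.Build R R phi power_frobenius_is_zmod_morphism.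
HB.instance Definition _ :=
  GRing.isMonoidMorphism.Build R R phi power_frobenius_is_monoid_morphism.

End PowerFrobenius.

(** * Roots over an algebraically closed field *)

Section ClosedField.

Variable K : closedFieldType.

Lemma separable_roots (P : {poly K}) : separable_poly P ->
  exists s : seq K, [/\ uniq s, size s = (size P).-1 & forall x, (x \in s) =
    root P x].
Proof.
move=> sepP; have P0 := separable_poly_neq0 sepP.
have [s defP] := closed_field_poly_normal P; have lP0 : lead_coef P != 0 by
  rewrite lead_coef_eq0.
exists s; split.
- by rewrite -separable_prod_XsubC -(eqp_separable (eqp_scale _ lP0)) -defP.
- by rewrite defP size_scale // size_prod_XsubC.
by move=> x; rewrite defP rootZ // root_prod_XsubC.
Qed.

(** The derivative of ['X^n - d] is a nonzero multiple of a power of ['X], and ['X] does not divide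
    the polynomial because [d != 0]; hence the polynomial is separable. *)
Lemma nth_roots (n : nat) (d : K) : n%:R != 0 :> K -> d != 0 ->
  exists s : seq K, [/\ uniq s, size s = n & forall x, (x \in s) = (x ^+ n ==
    d)].
Proof.
move=> n0 d0; have n_gt0 : (0 < n)%N by case: n n0; rewrite ?eqxx.
have [|s [us ss Ps]] := @separable_roots ('X^n - d%:P).
  rewrite separable_poly.unlock derivB derivC subr0 derivXn -scaler_nat
    coprimepZr //.
  apply: coprimep_expr; rewrite coprimepX rootE !hornerE.
  by rewrite expr0n gtn_eqF // sub0r oppr_eq0.
exists s; split=> // [|x]; first by rewrite ss size_XnsubC.
by rewrite Ps rootE !hornerE subr_eq0.
Qed.

Lemma exists_nth_root (n : nat) (d : K) : (0 < n)%N -> exists x, x ^+ n = d.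
Proof.
move=> n_gt0; have /closed_rootP[x] : size ('X^n - d%:P) != 1.
  by rewrite size_XnsubC // eqSS -lt0n.
by rewrite rootE !hornerE subr_eq0 => /eqP xn; exists x.
Qed.

End ClosedField.

(** * Points and lines over a finite subfield *)

Section RationalSubspaces.

Variables (K : fieldType) (m : nat).
Hypothesis charKm : [pchar K].-nat m.
Implicit Types (u v w : 'rV[K]_3) (P : {vspace 'rV[K]_3}).

Definition frob_mx r s (A : 'M[K]_(r, s)) : 'M[K]_(r, s) :=
  map_mx (fun x => x ^+ m) A.

Lemma frob_mxM r s t (A : 'M_(r, s)) (B : 'M_(s, t)) :
  frob_mx (A *m B) = frob_mx A *m frob_mx B.
Proof. exact: (map_mxM (power_frobenius charKm)). Qed.

Lemma frob_mxZ r s a (A : 'M_(r, s)) : frob_mx (a *: A) = a ^+ m *: frob_mx A.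
Proof. exact: (map_mxZ (power_frobenius charKm)). Qed.

Lemma frob_mxD r s (A B : 'M_(r, s)) : frob_mx (A + B) = frob_mx A + frob_mx B.
Proof. exact: (map_mxD (power_frobenius charKm)). Qed.

Lemma frob_mxB r s (A B : 'M_(r, s)) : frob_mx (A - B) = frob_mx A - frob_mx B.
Proof. exact: (map_mxB (power_frobenius charKm)). Qed.

Lemma frob_mx_scalar r (a : K) : frob_mx a%:M = (a ^+ m)%:M :> 'M_r.
Proof. exact: (map_scalar_mx (power_frobenius charKm)). Qed.

Lemma frob_mx_delta r s (i : 'I_r) (j : 'I_s) :
  frob_mx (delta_mx i j) = delta_mx i j.
Proof. exact: (map_delta_mx (power_frobenius charKm)). Qed.

Lemma rational_point v : v != 0 -> frob_mx v = v -> PG2_point m <[v]>%VS.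
Proof.
move=> v0 fv; split; first exact: is_point_line.
exists [:: v]; last by rewrite span_seq1.
by move=> w; rewrite inE => /eqP-> j; rewrite -[in RHS]fv mxE.
Qed.

Lemma rational_line u v : indep2 u v -> frob_mx u = u -> frob_mx v = v ->
  PG2_line m (<[u]> + <[v]>)%VS.
Proof.
move=> iuv fu fv; split; first exact: is_line_span2.
exists [:: u; v]; last by rewrite span2.
by move=> w; rewrite !inE => /orP[]/eqP-> j; rewrite -[in RHS](fu, fv) mxE.
Qed.

Lemma rational_pointP P : PG2_point m P ->
  exists w, [/\ w != 0, frob_mx w = w & P = <[w]>%VS].
Proof.
case=> dP [X fX defP]; have [w Xw w0] : exists2 w, w \in X & w != 0.
  apply/hasP; rewrite -[has _ _]negbK -all_predC; apply/negP => /allP X0.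
  have: (P <= 0)%VS.
    by rewrite defP; apply/span_subvP => x /X0; rewrite /= negbK memv0.
  by rewrite subv0 -dimv_eq0 dP.
exists w; split=> //; first by apply/rowP=> j; rewrite mxE fX.
apply/eqP; rewrite eq_sym eqEdim -memvE dP dim_vline w0 andbT.
by rewrite defP memv_span.
Qed.

(* Dividing [v] by one of its nonzero coordinates gives a rational vector. *)
Lemma frob_stable_point v a : v != 0 -> frob_mx v = a *: v ->
  exists w, [/\ w != 0, frob_mx w = w & <[v]>%VS = <[w]>%VS].
Proof.
move=> v0 fv; have [j vj] := vector_coord_neq0 v0.
exists ((v 0 j)^-1 *: v); split.
- by rewrite scaler_eq0 negb_or invr_eq0 vj.
- rewrite frob_mxZ fv scalerA; congr (_ *: _).
  (* Coordinate [j] shows that the Frobenius power multiplies [v 0 j] by [a], which cancels the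
     factor [a] of the vector. *)
  have := congr1 (fun w : 'rV_3 => w 0 j) fv; rewrite !mxE => e.
  have a0: a != 0.
    apply/eqP => a0; move/eqP: e.
    by rewrite a0 mul0r expf_eq0 (negPf vj) andbF.
  by rewrite exprVn e invfM mulrC mulrA mulfV // mul1r.
by rewrite vline_eqZ // invr_eq0.
Qed.

End RationalSubspaces.

(** * Scalar matrices and the order of a collineation *)

Section CollineationOrder.

(** A central matrix commutes with the transvections [1 + delta_mx i j], hence with every
    off-diagonal [delta_mx i j]; comparing entries kills the off-diagonal ones and equates the
    diagonal ones. *)
Lemma center_GL3P (F : finFieldType) (x : {'GL_3[F]}) :
  reflect (exists s, GLval x = s%:M) (x \in 'Z('GL_3[F]))%g.
Proof.
apply: (iffP (centerP _ _)) => [[_ cx]|[s xs]]; last first.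
  split; first by rewrite inE.
  move=> y _; apply: val_inj; rewrite -[LHS]/(GLval x *m GLval y) -[RHS]/(GLval
    y *m GLval x).
  by rewrite xs mul_scalar_mx mul_mx_scalar.
have cE (i j : 'I_3) : i != j -> GLval x *m delta_mx i j = delta_mx i j *m
  GLval x.
  move=> ij; have ji : j != i by rewrite eq_sym.
  have U : (1%:M + delta_mx i j : 'M[F]_3) \in unitmx.
    (* The inverse is [1 - delta_mx i j], because an off-diagonal elementary matrix squares to
       zero. *)
    have E: (1%:M + delta_mx i j) *m (1%:M - delta_mx i j) = 1%:M :> 'M[F]_3.
      rewrite mulmxDl mul1mx mulmxBr mulmx1 mul_delta_mx_0 // subr0.
      by rewrite addrAC -addrA subrr addr0.
    by case/mulmx1_unit: E.
  have := cx (FinRing.unit 'M[F]_3 U) (in_setT _) => /(congr1 val) /=.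
  by rewrite -!mulmxE mulmxDl mulmxDr mulmx1 mul1mx => /addrI.
have col_delta i j k l : (GLval x *m delta_mx i j) k l = GLval x k i *+ (l ==
  j).
  rewrite mxE (bigD1 i) //= big1 ?addr0 => [|m mi]; last first.
    by rewrite mxE (negPf mi) mulr0.
  by rewrite mxE eqxx mulr_natr.
have row_delta i j k l : (delta_mx i j *m GLval x) k l = GLval x j l *+ (k ==
  i).
  rewrite mxE (bigD1 j) //= big1 ?addr0 => [|m mj]; last first.
    by rewrite mxE (negPf mj) andbF mul0r.
  by rewrite mxE eqxx andbT mulr_natl.
exists (GLval x 0 0); apply/matrixP => k i; rewrite mxE.
have [j [_ [ji _ _ _]]] := ord3_others i.
have ij : i != j by rewrite eq_sym.
have [->|ki] := eqVneq k i; last first.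
  have /matrixP/(_ k j) := cE i j ij.
  by rewrite col_delta row_delta eqxx (negPf ki) mulr1n.
have [->//|i0] := eqVneq i 0.
have /matrixP/(_ i 0) := cE i 0 i0.
by rewrite col_delta row_delta !eqxx !mulr1n.
Qed.

Variables (F : finFieldType) (K : fieldType) (iota : {rmorphism F -> K}).
Variable sigma : PGL3 F.
Implicit Types (v w : 'rV[K]_3) (V W : {vspace 'rV[K]_3}).

Local Notation A := (map_mx iota (collineation_mx sigma)).

Lemma collineation_mx_unit : A \in unitmx.
Proof. by rewrite map_unitmx; apply: (valP (repr sigma)). Qed.

Lemma collineation_line v : collineation iota sigma <[v]>%VS = <[v *m A]>%VS.
Proof. by rewrite /collineation limg_line lfunE. Qed.

Lemma collineation_stable V :
  (forall v, v \in V -> v *m A \in V) -> collineation iota sigma V = V.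
Proof.
move=> sV; apply/eqP; rewrite eqEdim; apply/andP; split.
  by apply/subvP => _ /memv_imgP[v vV ->]; rewrite lfunE /= sV.
rewrite /collineation limg_dim_eq //; apply/eqP; rewrite -subv0.
apply/subvP => v; rewrite memv_cap => /andP[_]; rewrite memv_ker lfunE /= memv0.
move/eqP/(congr1 (mulmx^~ (invmx A))).
by rewrite mul0mx mulmxK ?collineation_mx_unit // => ->.
Qed.

Lemma collineation_eigen a v : v *m A = a *: v ->
  collineation iota sigma <[v]>%VS = <[v]>%VS.
Proof.
move=> vA; apply: collineation_stable => _ /vlineP[b ->].
by rewrite -scalemxAl vA !memvZ // memv_line.
Qed.

(** The kernel of the projection to [PGL3 F] is the group of scalar matrices. Stating this over [K]
    lets orders be computed from eigenvalues that need not lie in [F]. *)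
Lemma order_dvdP k : reflect (exists s : K, A ^+ k = s%:M) (#[sigma]%g %| k)%N.
Proof.
have nZ : repr sigma \in 'N('Z('GL_3[F]))%g.
  by apply: (subsetP (normal_norm (center_normal _))); rewrite inE.
have GLX (x : {'GL_3[F]}) : GLval (x ^+ k)%g = GLval x ^+ k.
  by elim: k => [|k IHk] //; rewrite expgS exprS -IHk.
have -> : (#[sigma]%g %| k)%N = (coset 'Z('GL_3[F]) (repr sigma ^+ k) == 1)%g.
  by rewrite order_dvdn morphX //= coset_reprK.
have -> : (coset 'Z('GL_3[F]) (repr sigma ^+ k) == 1)%g =
          ((repr sigma ^+ k)%g \in 'Z('GL_3[F]))%g.
  by apply/eqP/idP => [/coset_idr-> //|/coset_id]; rewrite ?groupX.
have AX : A ^+ k = map_mx iota (GLval (repr sigma ^+ k)%g).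
  by rewrite GLX rmorphXn.
apply: (iffP (center_GL3P _)) => [[s xs]|[s]]; rewrite AX.
  by exists (iota s); rewrite xs map_scalar_mx.
(* The scalar [s] descends to [F]: it is the image of a diagonal entry. *)
move=> xs; exists (GLval (repr sigma ^+ k)%g 0 0); apply/matrixP => i j.
apply: (fmorph_inj iota); rewrite !mxE rmorphMn /=.
have E a b : iota (GLval (repr sigma ^+ k)%g a b) = s *+ (a == b).
  by move/matrixP/(_ a b): xs; rewrite !mxE.
by rewrite !E.
Qed.

End CollineationOrder.

(** * The Hermitian form over the closed field *)

Section HermitianForm.

Variables (p n q : nat) (F : finFieldType) (K : closedFieldType).
Variables (iota : {rmorphism F -> K}) (M : {'GL_3[F]}).
Hypotheses (p_pr : prime p) (n_gt0 : (1 <= n)%N).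
Hypotheses (defq : q = (p ^ n)%N) (cardF : #|F| = (q ^ 2)%N).
Implicit Types (u v w x : 'rV[K]_3) (P l : {vspace 'rV[K]_3}).

Local Notation h := (hermitian_form iota q M).
Local Notation rational v := (frob_mx (q ^ 2) v = v).
Local Notation MK := (map_mx iota (GLval M)).

Lemma pcharK : p \in [pchar K].
Proof.
apply: (rmorph_pchar iota); apply: (@card_finPcharP _ _ (n * 2)) => //.
by rewrite cardF defq expnM.
Qed.

Lemma pcharK_q_power k : [pchar K].-nat (q ^ k)%N.
Proof.
by rewrite (eq_pnat _ (pcharf_eq pcharK)) defq -expnM pnatX pnat_id.
Qed.

Lemma pcharK_q : [pchar K].-nat q.
Proof. by have := pcharK_q_power 1; rewrite expn1. Qed.

Lemma q_gt1 : (1 < q)%N.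
Proof. by rewrite defq -(expn0 p) ltn_exp2l // prime_gt1. Qed.

Lemma q_gt0 : (0 < q)%N. Proof. exact: ltnW q_gt1. Qed.

Lemma q_eq0 : q%:R = 0 :> K.
Proof.
apply/eqP; rewrite -(dvdn_pcharf pcharK) defq.
by case: (n) n_gt0 => // k _; rewrite expnS dvdn_mulr.
Qed.

Lemma frobD (a b : K) : (a + b) ^+ q = a ^+ q + b ^+ q.
Proof. by rewrite exprDn_pchar // pcharK_q. Qed.

Lemma frobN (a : K) : (- a) ^+ q = - a ^+ q.
Proof. by rewrite exprNn_pchar // pcharK_q. Qed.

Lemma frob_inj : injective (fun a : K => a ^+ q).
Proof.
move=> a b /eqP; rewrite -subr_eq0 -frobN -frobD expf_eq0 q_gt0 subr_eq0.
by move/eqP.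
Qed.

Lemma frob2 (a : K) : (a ^+ q) ^+ q = a ^+ (q ^ 2).
Proof. by rewrite -exprM. Qed.

Lemma iota_fixed k (a : F) : iota a ^+ ((q ^ 2) ^ k) = iota a.
Proof.
have fix1: iota a ^+ (q ^ 2) = iota a by rewrite -rmorphXn -cardF expf_card.
by elim: k => [|k IHk]; rewrite ?expn0 ?expr1 // expnS exprM fix1.
Qed.

Lemma frob_map_mx k r s (A : 'M[F]_(r, s)) :
  frob_mx ((q ^ 2) ^ k) (map_mx iota A) = map_mx iota A.
Proof. by apply/matrixP => i j; rewrite !mxE iota_fixed. Qed.

Lemma map_GL_unit (N : {'GL_3[F]}) : map_mx iota (GLval N) \in unitmx.
Proof. by rewrite map_unitmx; apply: (valP N). Qed.

Lemma hermitian_eqE v : hermitian_eq iota q M v = h v v.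
Proof. by apply: eq_bigr => i _; rewrite exprS. Qed.

Lemma model_coordD u v :
  model_coord iota M (u + v) = model_coord iota M u + model_coord iota M v.
Proof. exact: mulmxDl. Qed.

Lemma model_coordZ a u : model_coord iota M (a *: u) = a *: model_coord iota M
  u.
Proof. by rewrite /model_coord scalemxAl. Qed.

Lemma hDl u v w : h (u + v) w = h u w + h v w.
Proof.
by rewrite -big_split; apply: eq_bigr => i _; rewrite model_coordD
  [fun_of_matrix (_ + _) _ _]mxE mulrDl.
Qed.

Lemma hDr u v w : h w (u + v) = h w u + h w v.
Proof.
rewrite -big_split; apply: eq_bigr => i _.
by rewrite model_coordD [fun_of_matrix (_ + _) _ _]mxE frobD mulrDr.
Qed.

Lemma hZl a u v : h (a *: u) v = a * h u v.
Proof.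
by rewrite big_distrr /=; apply: eq_bigr => i _; rewrite model_coordZ
  [fun_of_matrix (_ *: _) _ _]mxE mulrA.
Qed.

Lemma hZr a u v : h u (a *: v) = a ^+ q * h u v.
Proof.
rewrite big_distrr /=; apply: eq_bigr => i _.
by rewrite model_coordZ [fun_of_matrix (_ *: _) _ _]mxE exprMn mulrCA.
Qed.

Lemma h0l v : h 0 v = 0.
Proof. by rewrite -(scale0r (0 : 'rV_3)) hZl mul0r. Qed.

Lemma h0r v : h v 0 = 0.
Proof. by rewrite -(scale0r (0 : 'rV_3)) hZr expr0n gtn_eqF ?q_gt0 ?mul0r. Qed.

Lemma hNl u v : h (- u) v = - h u v.
Proof. by rewrite -scaleN1r hZl mulN1r. Qed.

Lemma hNr u v : h u (- v) = - h u v.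
Proof. by rewrite -scaleN1r hZr frobN expr1n mulN1r. Qed.

Lemma h_suml r (f : 'I_r -> 'rV[K]_3) v : h (\sum_i f i) v = \sum_i h (f i) v.
Proof.
by apply: (big_morph (h^~ v)) => [x y|]; [exact: hDl | exact: h0l].
Qed.

Lemma h_sumr r (f : 'I_r -> 'rV[K]_3) v : h v (\sum_i f i) = \sum_i h v (f i).
Proof. by apply: (big_morph (h v)) => [x y|]; [exact: hDr | exact: h0r]. Qed.

Definition hlinE := (hDl, hDr, hZl, hZr, hNl, hNr).

(* The two arguments are exchanged, but one of them is also moved by the      *)
(* Frobenius map of order [q ^ 2]; on rational vectors [h] is Hermitian.      *)
Lemma h_conj u v : h u v ^+ q = h (frob_mx (q ^ 2) v) u.
Proof.
rewrite -[LHS]/(power_frobenius pcharK_q _) rmorph_sum /=.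
apply: eq_bigr => i _; rewrite /power_frobenius exprMn frob2 mulrC.
congr (_ * _); rewrite /model_coord -[MK in RHS](@frob_map_mx 1) expn1.
by rewrite -frob_mxM ?pcharK_q_power // [RHS]mxE.
Qed.

(** In model coordinates the form is standard, so it suffices to take for [x] a coordinate vector at
    an index where [v] does not vanish. *)
Lemma h_nondegenerate v : v != 0 -> exists x, h x v != 0.
Proof.
move=> v0; have: model_coord iota M v != 0.
  apply: contraNneq v0 => /(congr1 (mulmx^~ (invmx MK))).
  by rewrite mul0mx /model_coord mulmxK ?map_GL_unit // => ->.
move=> /vector_coord_neq0[j vj]; exists (delta_mx 0 j *m invmx MK).
rewrite /hermitian_form /model_coord mulmxKV ?map_GL_unit // (bigD1 j) //=.
rewrite big1 ?addr0 => [|i ij]; last by rewrite mxE (negPf ij) mul0r.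
by rewrite mxE !eqxx mul1r expf_neq0.
Qed.

Lemma h_rational_sym u v : rational v -> h u v ^+ q = h v u.
Proof. by move=> rv; rewrite h_conj rv. Qed.

Lemma h_rational u v : rational u -> rational v -> h u v ^+ (q ^ 2) = h u v.
Proof. by move=> ru rv; rewrite -frob2 !h_rational_sym. Qed.

Lemma h_sym_eq0 u v : rational v -> (h u v == 0) = (h v u == 0).
Proof. by move=> rv; rewrite -(h_rational_sym u rv) expf_eq0 q_gt0. Qed.

(** Pairing a relation with [u] leaves only the coefficient of [x]. *)
Lemma indep3_extend a b x u : indep2 a b -> h a u = 0 -> h b u = 0 ->
  h x u != 0 -> indep3 a b x.
Proof.
move=> iab hau hbu hxu s t r e.
have r0: r = 0.
  move/(congr1 (h^~ u))/eqP: e; rewrite !hlinE hau hbu h0l !mulr0 !add0r.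
  by rewrite mulf_eq0 (negPf hxu) orbF => /eqP.
by move: e; rewrite r0 scale0r addr0 => /iab[-> ->].
Qed.

Lemma h_basis_neq0 a b c v : indep3 a b c -> v != 0 ->
  [|| h a v != 0, h b v != 0 | h c v != 0].
Proof.
move=> iabc /h_nondegenerate[x]; apply: contraR; rewrite !negb_or !negbK.
have [s [t [r ->]]] := indep3_basis x iabc; rewrite !hlinE.
by case/and3P=> /eqP-> /eqP-> /eqP->; rewrite !mulr0 !addr0.
Qed.

(** If the form vanished on the plane, a suitable nonzero vector of the plane would also be
    orthogonal to a third basis vector [x], against nondegeneracy. All four values appear because
    [h] is not Hermitian on vectors that are not rational. *)
Lemma not_totally_isotropic u v : indep2 u v ->
  [|| h u u != 0, h u v != 0, h v u != 0 | h v v != 0].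
Proof.
move=> iuv; apply/negPn; rewrite !negb_or !negbK.
apply/negP=> /and4P[/eqP huu /eqP huv /eqP hvu /eqP hvv].
have [u0 v0] := indep2_nonzero iuv; have [x hxu] := h_nondegenerate u0.
have iuvx := indep3_extend iuv huu hvu hxu.
(* The form is [q]-semilinear on the right, so [q]-th roots are needed to make
   [h x (a *: u + b *: v)] vanish. *)
have [a aq] := exists_nth_root (h x v) q_gt0.
have [b bq] := exists_nth_root (- h x u) q_gt0.
have y0: a *: u + b *: v != 0.
  apply: contraNneq hxu => /iuv[_ b0].
  by rewrite -oppr_eq0 -bq b0 expr0n gtn_eqF ?q_gt0.
have := h_basis_neq0 iuvx y0.
rewrite !hlinE huu huv hvu hvv aq bq !mulr0 !addr0 eqxx /=.
by rewrite mulrC mulNr subrr eqxx.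
Qed.

Lemma on_hermitian_line v : v != 0 ->
  on_hermitian iota q M <[v]>%VS <-> h v v = 0.
Proof.
move=> v0; split=> [[_ hv]|hv].
  by rewrite -hermitian_eqE hv // memv_line.
split; first exact: is_point_line.
by move=> w /vlineP[a ->]; rewrite hermitian_eqE !hlinE hv !mulr0.
Qed.

(** Nondegeneracy supplies a vector [y] not orthogonal to [u]; in the basis [a], [b], [y],
    orthogonality to [u] means a zero coefficient at [y]. *)
Lemma mem_polar a b u x : indep2 a b -> u != 0 -> h a u = 0 -> h b u = 0 ->
  (x \in (<[a]> + <[b]>)%VS) = (h x u == 0).
Proof.
move=> iab u0 hau hbu; apply/idP/eqP => [/mem_line2[s [t ->]]|hxu].
  by rewrite !hlinE hau hbu !mulr0 addr0.
have [y hyu] := h_nondegenerate u0.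
have [s [t [r defx]]] := indep3_basis x (indep3_extend iab hau hbu hyu).
move/eqP: hxu; rewrite defx !hlinE hau hbu !mulr0 !add0r mulf_eq0 (negPf hyu).
by rewrite orbF => /eqP->; rewrite scale0r addr0 line2_mem.
Qed.

(** * Polar lines of rational points: tangents and chords *)

Lemma pole_polar_line u a b : u != 0 -> rational u -> indep2 a b ->
    rational a -> rational b -> h a u = 0 -> h b u = 0 ->
  pole_polar iota q M <[u]>%VS (<[a]> + <[b]>)%VS.
Proof.
move=> u0 ru iab ra rb hau hbu.
split; [exact: rational_point | exact: rational_line |].
move=> x _ /vlineP[c ->]; rewrite scaler_eq0 negb_or => /andP[c0 _].
by rewrite (mem_polar _ iab u0) // hZr mulf_eq0 expf_eq0 q_gt0 (negPf c0).
Qed.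

(** The polar is the kernel of a nonzero functional. For rational [u] its coefficients are fixed by
    the Frobenius map, and so is the basis of the kernel. *)
Lemma polar_basis u : u != 0 ->
  exists a b, [/\ indep2 a b, h a u = 0, h b u = 0
    & rational u -> rational a /\ rational b].
Proof.
move=> u0; pose f (i : 'I_3) := h (delta_mx 0 i) u.
have fE x : \sum_i x 0 i * f i = h x u.
  by rewrite [x in RHS]row_sum_delta h_suml; apply: eq_bigr => i _; rewrite hZl.
have [k fk] : exists k, f k != 0.
  have [x hxu] := h_nondegenerate u0; apply/existsP; apply: contraR hxu.
  by move=> /existsPn f0; rewrite -fE big1 // => i _; move: (f0 i); rewrite
    negbK => /eqP->; rewrite mulr0.
have [a [b [iab _ [fa fb] rab]]] := functional_kernel_basis fk.
exists a, b; split; rewrite -?fE // => ru.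
apply: (rab (power_frobenius (pcharK_q_power 2))) => i.
by apply: h_rational ru; rewrite frob_mx_delta ?pcharK_q_power.
Qed.

(** A second isotropic rational point on the polar line of [u] would span with [u] a totally
    isotropic plane. *)
Lemma tangent_polar u a b : u != 0 -> rational u -> h u u = 0 -> indep2 a b ->
    rational a -> rational b -> h a u = 0 -> h b u = 0 ->
  tangent iota q M (<[a]> + <[b]>)%VS.
Proof.
move=> u0 ru huu iab ra rb hau hbu; split; first exact: rational_line.
exists [:: <[u]>%VS]; split=> // P; rewrite inE; split=> [/eqP->|].
  split; [exact: rational_point | exact/on_hermitian_line |].
  by rewrite -memvE (mem_polar _ iab u0) ?huu.
case=> /rational_pointP[w [w0 rw ->]] /on_hermitian_line-/(_ w0) hww.
rewrite -memvE (mem_polar _ iab u0) // => hwu; apply/eqP.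
have hwu' : h u w == 0 by rewrite h_sym_eq0.
have [/vlineP[c defw]|wu] := boolP (w \in <[u]>%VS).
  by rewrite defw vline_eqZ //; apply: contraNneq w0 => c0; rewrite defw c0
    scale0r.
have := not_totally_isotropic (not_collinear_indep2 u0 wu).
by rewrite huu hww hwu hwu' eqxx.
Qed.
(** The polynomial ['X^q + 'X] has at most [q] roots, whereas [F] has [q ^ 2] elements. *)
Lemma exists_trace_neq0 : exists t : K, t ^+ (q ^ 2) = t /\ t ^+ q + t != 0.
Proof.
pose P : {poly K} := 'X^q + 'X; have sP : size P = q.+1.
  by rewrite size_polyDl size_polyXn // size_polyX !ltnS q_gt1.
have [a ta] : exists a : F, ~~ root P (iota a).
  apply/existsP; rewrite -[[exists _, _]]negbK; apply/negP => /existsPn r.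
  have: (size [seq iota a | a <- enum F] < size P)%N.
    apply: max_poly_roots; first by rewrite -size_poly_eq0 sP.
      by apply/allP=> _ /mapP[a _ ->]; rewrite -[root _ _]negbK r.
    by rewrite map_inj_uniq ?enum_uniq //; apply: fmorph_inj.
  rewrite size_map -cardE cardF sP ltnS leqNgt -{1}(expn1 q).
  by rewrite ltn_exp2l ?q_gt1.
exists (iota a); have := iota_fixed 1 a; rewrite expn1 => ->; split=> //.
by rewrite rootE !hornerE in ta.
Qed.

(** The coefficients are exposed so that orthogonality to a pole passes to the new vectors by
    linearity. *)
Lemma exists_nonisotropic a b : indep2 a b -> rational a -> rational b ->
  exists s t s' t', [/\ indep2 (s *: a + t *: b) (s' *: a + t' *: b),
    rational (s *: a + t *: b), rational (s' *: a + t' *: b)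
    & h (s *: a + t *: b) (s *: a + t *: b) != 0].
Proof.
move=> iab ra rb; have [haa|haa] := eqVneq (h a a) 0; last first.
  by exists 1, 0, 0, 1; rewrite !scale1r !scale0r addr0 add0r.
have [hbb|hbb] := eqVneq (h b b) 0; last first.
  exists 0, 1, 1, 0; rewrite !scale1r !scale0r addr0 add0r; split=> //.
  exact: indep2_sym.
have hab : h a b != 0.
  have := not_totally_isotropic iab.
  by rewrite haa hbb eqxx orbF -(h_sym_eq0 _ rb) orbb.
have [s [s2 str]] := exists_trace_neq0.
(* With this coefficient the form takes the value [s ^+ q + s] on the first vector. *)
exists 1, (s / h b a), 0, 1; rewrite !scale1r !scale0r add0r.
have hba : h b a != 0 by rewrite -h_sym_eq0.
split=> //.
- move=> c d; rewrite scalerDr scalerA -addrA -scalerDl => /iab[-> ].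
  by rewrite mul0r add0r.
- rewrite frob_mxD ?frob_mxZ ?pcharK_q_power // ra rb expr_div_n s2.
  by rewrite h_rational.
rewrite !hlinE haa hbb expr_div_n (h_rational_sym b ra) !mulr0 add0r addr0.
by rewrite !divfK // addrC.
Qed.

(** This is one Gram-Schmidt step on the polar line of [u]. The second vector is not isotropic,
    being orthogonal to the other two members of a basis. *)
Lemma exists_orthogonal_basis u a b : u != 0 -> rational u -> h u u != 0 ->
    indep2 a b -> rational a -> rational b -> h a u = 0 -> h b u = 0 ->
  exists e f, [/\ indep2 e f, rational e /\ rational f, h e u = 0 /\ h f u = 0,
    h e f = 0 /\ h f e = 0 & h e e != 0 /\ h f f != 0].
Proof.
move=> u0 ru huu iab ra rb hau hbu.
have [s [t [s' [t' []]]]] := exists_nonisotropic iab ra rb.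
have: h (s *: a + t *: b) u = 0 by rewrite !hlinE hau hbu !mulr0 addr0.
have: h (s' *: a + t' *: b) u = 0 by rewrite !hlinE hau hbu !mulr0 addr0.
move: (s *: a + t *: b) (s' *: a + t' *: b) => e g hgu heu ieg re rg hee.
pose f := g + (- (h g e / h e e)) *: e.
have hfe : h f e = 0 by rewrite !hlinE mulNr divfK // subrr.
have hfu : h f u = 0 by rewrite !hlinE hgu heu mulr0 addr0.
have rf : rational f.
  rewrite frob_mxD ?frob_mxZ ?pcharK_q_power // re rg exprNn_pchar
    ?pcharK_q_power //.
  by rewrite expr_div_n !h_rational.
have ief : indep2 e f.
  move=> c d; rewrite /f scalerDr scalerA addrCA -scalerDl addrC => /ieg[e1 d0].
  by move: e1; rewrite d0 mul0r addr0.
have hef : h e f = 0 by apply/eqP; rewrite h_sym_eq0 // hfe.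
exists e, f; split=> //; split=> //.
have huf : h u f = 0 by apply/eqP; rewrite h_sym_eq0 // hfu.
have [_ f0] := indep2_nonzero ief.
have := h_basis_neq0 (indep3_extend ief heu hfu huu) f0.
by rewrite hef huf eqxx orbF.
Qed.

(** In an orthogonal basis [e], [f] of the line, the isotropic points are those spanned by
    [e + z *: f] with [z ^+ q.+1 = d]. There are [q.+1] such [z], since [q.+1] is nonzero in [K]. *)
Lemma chord_polar u a b : u != 0 -> rational u -> h u u != 0 -> indep2 a b ->
    rational a -> rational b -> h a u = 0 -> h b u = 0 ->
  chord iota q M (<[a]> + <[b]>)%VS.
Proof.
move=> u0 ru huu iab ra rb hau hbu; split; first exact: rational_line.
have [e [f [ief [re rf] [heu hfu] [hef hfe] [hee hff]]]] :=
  exists_orthogonal_basis u0 ru huu iab ra rb hau hbu.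
pose d := - (h e e / h f f).
have d0 : d != 0 by rewrite oppr_eq0 mulf_neq0 ?invr_eq0.
have q1 : q.+1%:R != 0 :> K by rewrite -addn1 natrD q_eq0 add0r oner_eq0.
have [s [us ss sE]] := nth_roots q1 d0.
have isoE z : (h (e + z *: f) (e + z *: f) == 0) = (z \in s).
  rewrite sE !hlinE hef hfe !mulr0 addr0 add0r mulrA -exprS.
  by rewrite -[RHS](inj_eq (mulIf hff)) mulNr divfK // addrC addr_eq0.
have pt0 z : e + z *: f != 0.
  by apply/eqP => z0; case: (ief 1 z) => [|/eqP]; rewrite ?scale1r ?oner_eq0.
exists [seq <[e + z *: f]>%VS | z <- s]; rewrite size_map ss; split=> //.
  rewrite map_inj_in_uniq // => z z' _ _ zz'.
  have /vlineP[c] : e + z *: f \in <[e + z' *: f]>%VS by rewrite -zz' memv_line.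
  move=> E; have [|/eqP] := ief (1 - c) (z - c * z').
    by rewrite !scalerBl scale1r -scalerA addrACA -opprD -scalerDr -E subrr.
  by rewrite subr_eq0 => /eqP<- /eqP; rewrite mul1r subr_eq0 => /eqP.
move=> P; split=> [/mapP[z zs ->]|].
  have z0 : z != 0.
    by apply: contraTneq zs => ->; rewrite sE expr0n /= eq_sym.
  split.
  - apply: rational_point => //.
    rewrite frob_mxD ?frob_mxZ ?pcharK_q_power // re rf; congr (_ + _ *: _).
    (* Comparing [z ^+ q.+1] with its own [q]-th power gives [z ^+ (q ^ 2) = z], so the point is
       rational. *)
    move: zs; rewrite sE => /eqP zs; have: d ^+ q = d.
      by rewrite frobN expr_div_n !h_rational_sym.
    by rewrite -zs exprSr exprMn frob2 [RHS]mulrC; apply/mulIf/expf_neq0.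
  - by apply/on_hermitian_line => //; apply/eqP; rewrite isoE.
  by rewrite -memvE (mem_polar _ iab u0) // !hlinE heu hfu mulr0 addr0.
case=> [[/is_pointP[w w0 ->] _] /on_hermitian_line-/(_ w0) hww].
rewrite -memvE (mem_polar _ iab u0) // -(mem_polar _ ief u0) //.
case/mem_line2=> c [c' defw]; apply/mapP.
(* The point spanned by [f] is not isotropic, so the coefficient at [e] can be normalized to 1. *)
have c0 : c != 0.
  apply: contraNneq w0 => c0; move/eqP: hww; rewrite defw c0 scale0r add0r.
  by rewrite !hlinE !mulf_eq0 expf_eq0 q_gt0 (negPf hff) orbF orbb => /eqP->;
    rewrite scale0r.
have wE : w = c *: (e + (c' / c) *: f).
  by rewrite defw scalerDr scalerA mulrC divfK.
exists (c' / c); last by rewrite wE vline_eqZ.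
by move/eqP: hww; rewrite -isoE {1 2}wE hZl hZr !mulf_eq0 expf_eq0 q_gt0 (negPf
  c0).
Qed.
(* In coordinates where [h] is the standard form, testing the points          *)
(* [e_i + z e_j] with [z ^+ q.+1 = -1] kills the polynomial                   *)
(* [S_ij X^q + S_ji X + (S_ii - S_jj)], [S] being the Gram matrix of the      *)
(* transformed form: it has [q.+1] roots but degree at most [q].              *)
Lemma similitude_of_isotropic (A : 'M[K]_3) :
    (forall v, v != 0 -> h v v = 0 -> h (v *m A) (v *m A) = 0) ->
  exists c, forall u v, h (u *m A) (v *m A) = c * h u v.
Proof.
move=> isoA; pose e (i : 'I_3) : 'rV[K]_3 := delta_mx 0 i *m invmx MK.
have eMK i : e i *m MK = delta_mx 0 i by rewrite mulmxKV ?map_GL_unit.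
have eE v : v = \sum_i (v *m MK) 0 i *: e i.
  under eq_bigr do rewrite scalemxAl.
  by rewrite -mulmx_suml -row_sum_delta mulmxK ?map_GL_unit.
have hee i j : h (e i) (e j) = (i == j)%:R.
  rewrite /hermitian_form /model_coord !eMK (bigD1 i) //= big1 => [|k ki].
    rewrite !mxE !eqxx mul1r addr0; case: eqP => _; rewrite ?expr1n //.
    by rewrite expr0n gtn_eqF ?q_gt0.
  by rewrite !mxE (negPf ki) mul0r.
pose S i j := h (e i *m A) (e j *m A).
have hZA r (x y : 'I_r -> K) (a b : 'I_r -> 'rV[K]_3) :
    h (\sum_i x i *: a i) (\sum_i y i *: b i) =
    \sum_i \sum_j x i * (y j ^+ q * h (a i) (b j)).
  rewrite h_suml; apply: eq_bigr => i _; rewrite hZl h_sumr mulr_sumr.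
  by apply: eq_bigr => j _; rewrite hZr.
have S_diag i j : i != j -> S i j = 0 /\ S i i = S j j.
  move=> ij; have q1 : q.+1%:R != 0 :> K by rewrite -addn1 natrD q_eq0 add0r
    oner_eq0.
  have [|s [us ss sE]] := nth_roots q1 (_ : -1 != 0 :> K).
    by rewrite oppr_eq0 oner_eq0.
  pose P : {poly K} := S i j *: 'X^q + S j i *: 'X + (S i i - S j j)%:P.
  have sP : (size P <= q.+1)%N.
    rewrite (leq_trans (size_polyD _ _)) // geq_max (leq_trans (size_polyD _
      _)) /=.
      by rewrite (leq_trans (size_polyC_leq1 _)).
    rewrite geq_max !(leq_trans (size_scale_leq _ _)) ?size_polyXn ?size_polyX
      //.
    by rewrite ltnS q_gt0.
  have P0 : P = 0.
    apply/eqP; apply: contraTT sP => P0; rewrite -ltnNge -ss.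
    apply: max_poly_roots => //; apply/allP => z; rewrite sE => /eqP zq.
    have z0 : e i + z *: e j != 0.
      apply/eqP => /(congr1 (h^~ (e i)))/eqP; rewrite !hlinE h0l !hee eqxx.
      by rewrite [j == i]eq_sym (negPf ij) mulr0 addr0 oner_eq0.
    have := isoA _ z0; rewrite mulmxDl -scalemxAl !hlinE !hee !eqxx.
    rewrite [j == i]eq_sym (negPf ij) !mulr0 addr0 add0r mulr1 -exprS zq.
    rewrite subrr => /(_ erefl) E.
    rewrite rootE /P !hornerD !hornerZ hornerXn hornerX hornerC.
    (* The relation [z ^+ q.+1 = -1] turns the last term of the expanded form into the constant
       [- S j j] of the polynomial. *)
    have Sz : S j j = - (z * (z ^+ q * S j j)) by rewrite mulrA -exprS zq
      mulN1r opprK.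
    by rewrite [X in _ - X]Sz -[X in _ == X]E /S; apply/eqP; ring.
  have coefs k : P`_k = 0 by rewrite P0 coef0.
  (* Since [1 < q], the coefficient at [q] is [S i j] alone; the constant coefficient equates the
     diagonal entries. *)
  have := coefs 0%N; have := coefs q.
  rewrite !coefE !eqxx (gtn_eqF q_gt0) [(0 == q)%N](ltn_eqF q_gt0) (gtn_eqF
    q_gt1).
  rewrite !mulr0 mulr1 !add0r !addr0 => -> /eqP; rewrite subr_eq0.
  by move/eqP.
exists (S 0 0) => u v; rewrite {1}(eE u) {1}(eE v) !mulmx_suml.
under eq_bigr do rewrite -scalemxAl.
under [in X in h _ X]eq_bigr do rewrite -scalemxAl.
rewrite hZA [in RHS]/hermitian_form mulr_sumr; apply: eq_bigr => i _.
rewrite (bigD1 i) //= big1 ?addr0 => [|j ji].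
  rewrite -/(S i i); have [->|i0] := eqVneq i 0; first by rewrite mulrA mulrC.
  by rewrite (S_diag i 0 i0).2 mulrA mulrC.
have ij : i != j by rewrite eq_sym.
by rewrite -/(S i j) (S_diag i j ij).1 !mulr0.
Qed.

(** * The similitude induced by the collineation and its eigenvalues *)

Variable sigma : PGL3 F.
Hypotheses (sigmaH : in_PGU3 iota q M sigma) (sigma_neq1 : sigma != 1%g).

Local Notation A := (map_mx iota (collineation_mx sigma)).

Lemma collineation_similitude :
  exists c, forall u v, h (u *m A) (v *m A) = c * h u v.
Proof.
apply: similitude_of_isotropic => v v0 hvv.
have vA0 : v *m A != 0.
  apply: contraNneq v0 => /(congr1 (mulmx^~ (invmx A))).
  by rewrite mul0mx mulmxK ?collineation_mx_unit // => ->.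
apply/(on_hermitian_line vA0); rewrite -collineation_line.
by apply/(sigmaH (is_point_line v0))/on_hermitian_line.
Qed.

Variable c : K.
Hypothesis hA : forall u v, h (u *m A) (v *m A) = c * h u v.

Lemma frob_A : frob_mx (q ^ 2) A = A.
Proof. by have := frob_map_mx 1 (collineation_mx sigma); rewrite expn1. Qed.

Lemma exists_h_neq0 : exists u v, h u v != 0.
Proof.
have d0 : delta_mx 0 0 != 0 :> 'rV[K]_3.
  by apply/eqP => /rowP/(_ 0)/eqP; rewrite !mxE !eqxx oner_eq0.
by have [x hx] := h_nondegenerate d0; exists x, (delta_mx 0 0).
Qed.

Lemma c_neq0 : c != 0.
Proof.
have [u [v huv]] := exists_h_neq0; apply: contraNneq huv => c0.
have := hA (u *m invmx A) (v *m invmx A).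
by rewrite !mulmxKV ?collineation_mx_unit // c0 mul0r => ->.
Qed.

(** Raising the similitude identity to the power [q] exchanges the arguments of the form up to a
    Frobenius map that fixes [A]; the factor becomes [c] again. *)
Lemma c_frob : c ^+ q = c.
Proof.
have [u [v huv]] := exists_h_neq0.
have: h (u *m A) (v *m A) ^+ q = c * h u v ^+ q.
  by rewrite h_conj frob_mxM ?pcharK_q_power // frob_A hA -h_conj.
by rewrite hA exprMn; apply/mulIf/expf_neq0.
Qed.

Lemma eigenvalue_neq0 a v : v != 0 -> v *m A = a *: v -> a != 0.
Proof.
move=> v0 vA; apply: contraNneq v0 => a0; rewrite a0 scale0r in vA.
by rewrite -(mulmxK (collineation_mx_unit iota sigma) v) vA mul0mx.
Qed.

(* Eigenvalues are thus permuted by [b |-> c / b ^+ q]; how this involution-like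
   map acts separates the cases of the theorem. *)
Lemma eigenvalue_pair a b u v : u *m A = a *: u -> v *m A = b *: v ->
  h u v != 0 -> a * b ^+ q = c.
Proof.
move=> uA vA huv; apply: (mulIf huv).
by rewrite -hA uA vA hZl hZr mulrA.
Qed.

(** Raise [a * a ^+ q = c] to the power [q], use [c ^+ q = c] and cancel [a ^+ q]. *)
Lemma eigenvalue_rational a : a * a ^+ q = c -> a ^+ (q ^ 2) = a.
Proof.
move=> ac; have a0 : a != 0.
  by apply: contraNneq c_neq0 => a0; rewrite -ac a0 mul0r.
have := c_frob; rewrite -[in LHS]ac exprMn frob2 -ac mulrC.
by apply/mulIf/expf_neq0.
Qed.

(** The entries of [A] come from [F], so [A] is fixed by the Frobenius map. *)
Lemma frob_eigenvector k a v : v *m A = a *: v ->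
  frob_mx ((q ^ 2) ^ k) v *m A =
  a ^+ ((q ^ 2) ^ k) *: frob_mx ((q ^ 2) ^ k) v.
Proof.
have Hk : [pchar K].-nat ((q ^ 2) ^ k)%N by rewrite -expnM pcharK_q_power.
by move=> vA; rewrite -[A](frob_map_mx k) -frob_mxM // vA frob_mxZ.
Qed.

Lemma frob_eigenvector1 a v : v *m A = a *: v -> a ^+ (q ^ 2) = a ->
  frob_mx (q ^ 2) v *m A = a *: frob_mx (q ^ 2) v.
Proof.
by move=> /(frob_eigenvector 1) vA aq; move: vA; rewrite expn1 aq.
Qed.

(** * Orders from scalar powers *)

Lemma A_not_scalar s : A <> s%:M.
Proof.
move=> As; case/negP: sigma_neq1; rewrite -order_eq1 -dvdn1.
by apply/(order_dvdP iota); exists s; rewrite expr1.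
Qed.

Lemma order_neq1 : #[sigma]%g != 1%N.
Proof. by rewrite order_eq1. Qed.

Lemma eigenvector_expr a v k : v *m A = a *: v -> v *m A ^+ k = a ^+ k *: v.
Proof.
move=> vA; elim: k => [|k IHk]; first by rewrite !expr0 mulmx1 scale1r.
by rewrite exprSr -mulmxE mulmxA IHk -scalemxAl vA scalerA exprSr.
Qed.

Lemma mx_eq_on_basis (B C : 'M[K]_3) u v w : indep3 u v w ->
  u *m B = u *m C -> v *m B = v *m C -> w *m B = w *m C -> B = C.
Proof.
move=> iuvw uE vE wE; apply/row_matrixP => i; rewrite !rowE.
have [x [y [z ->]]] := indep3_basis (delta_mx 0 i) iuvw.
by rewrite !mulmxDl -!scalemxAl uE vE wE.
Qed.

Lemma order_dvd_eigenvalues u v w (x y z s : K) k : indep3 u v w ->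
  u *m A = x *: u -> v *m A = y *: v -> w *m A = z *: w ->
  x ^+ k = s -> y ^+ k = s -> z ^+ k = s -> (#[sigma]%g %| k)%N.
Proof.
move=> iuvw uA vA wA xs ys zs; apply/(order_dvdP iota); exists s.
apply: (mx_eq_on_basis iuvw); rewrite mul_mx_scalar.
- by rewrite (eigenvector_expr k uA) xs.
- by rewrite (eigenvector_expr k vA) ys.
by rewrite (eigenvector_expr k wA) zs.
Qed.

Lemma eigenvalue_expr_scalar a v k s : v != 0 -> v *m A = a *: v ->
  A ^+ k = s%:M -> a ^+ k = s.
Proof.
move=> v0 /(eigenvector_expr k) vAk Ak; apply/eqP; rewrite -subr_eq0.
move/eqP: vAk; rewrite Ak mul_mx_scalar eq_sym -subr_eq0 -scalerBl.
by rewrite scaler_eq0 (negPf v0) orbF.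
Qed.

(** The scalar part commutes with [A], so raising to the power [p] is additive on the sum. *)
Lemma expr_nilpotent_part a k : A ^+ (p ^ k) = (a ^+ (p ^ k))%:M + (A - a%:M)
  ^+ (p ^ k).
Proof.
have charM : p \in [pchar 'M[K]_3].
  exact: (rmorph_pchar (@scalar_mx K 3 : {rmorphism K -> 'M[K]_3}) pcharK).
elim: k => [|k IHk]; first by rewrite expn0 !expr1 addrC subrK.
rewrite expnSr !exprM {}IHk -[LHS](pFrobenius_autE charM) pFrobenius_autD_comm.
  by rewrite !pFrobenius_autE -rmorphXn.
by rewrite /GRing.comm -!mulmxE mul_scalar_mx mul_mx_scalar.
Qed.

Lemma order_dvd_p_power a k : (A - a%:M) ^+ (p ^ k) = 0 -> (#[sigma]%g %| p ^
  k)%N.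
Proof.
move=> N0; apply/(order_dvdP iota); exists (a ^+ (p ^ k)).
by rewrite (expr_nilpotent_part a) N0 addr0.
Qed.

Lemma order_eq_p a k : (k <= p)%N -> (A - a%:M) ^+ k = 0 -> #[sigma]%g = p.
Proof.
move=> kp N0; apply/(prime_nt_dvdP p_pr order_neq1).
rewrite -[X in (_ %| X)%N]expn1; apply: (order_dvd_p_power (a := a)).
by rewrite expn1 -(subnK kp) exprD N0 mulr0.
Qed.

(* Here [x A = a x + f(x) u]; comparing [h (w A) (y A)] with [c * h w y] for [w]
   in the kernel of [f] shows that this kernel is the polar line of [u]. *)
Lemma perspectivity_case (a : K) : (\rank (A - a%:M)%R <= 1)%N ->
  case_A iota q M sigma \/ case_C iota p q M sigma.
Proof.
set N := A - a%:M => rkN.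
have AE x : x *m A = a *: x + x *m N.
  by rewrite mulmxBr mul_mx_scalar addrC subrK.
have N0 : N != 0.
  by apply/eqP => /eqP; rewrite subr_eq0 => /eqP; apply: A_not_scalar.
have [k [j [Nkj xN]]] := rank1_decomposition N0 rkN.
pose f i := N i j / N k j; pose u := row k N.
have u0 : u != 0.
  by apply: contraNneq Nkj => /rowP/(_ j)/eqP; rewrite !mxE.
have fk : f k != 0 by rewrite /f divff ?oner_eq0.
have [b [d [ibd _ [fb fd] rbd]]] := functional_kernel_basis fk.
have bN : b *m N = 0 by rewrite xN fb scale0r.
have dN : d *m N = 0 by rewrite xN fd scale0r.
have bA : b *m A = a *: b by rewrite AE bN addr0.
have dA : d *m A = a *: d by rewrite AE dN addr0.
(* The kernel of [N] is a plane of eigenvectors for [a]; it is not totally isotropic, so [a] is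
   paired with itself. *)
have ac : a * a ^+ q = c.
  case/or4P: (not_totally_isotropic ibd).
  - exact: (eigenvalue_pair bA bA).
  - exact: (eigenvalue_pair bA dA).
  - exact: (eigenvalue_pair dA bA).
  exact: (eigenvalue_pair dA dA).
have a0 : a != 0 by apply: contraNneq c_neq0 => a0; rewrite -ac a0 mul0r.
have q2 : [pchar K].-nat (q ^ 2)%N by rewrite pcharK_q_power.
have rN : frob_mx (q ^ 2) N = N.
  by rewrite frob_mxB // frob_A frob_mx_scalar // eigenvalue_rational.
have Nij i i' : N i i' ^+ (q ^ 2) = N i i' by rewrite -[in RHS]rN [RHS]mxE.
have ru : rational u by rewrite /u rowE frob_mxM // frob_mx_delta // rN.
have [rb rd] : rational b /\ rational d.
  apply: (rbd (power_frobenius q2)) => i.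
  by rewrite -[LHS]/((N i j / N k j) ^+ (q ^ 2)) expr_div_n !Nij.
have h_ker w : w *m N = 0 -> h w u = 0.
  move=> wN; have := hA w (delta_mx 0 k).
  rewrite !AE wN addr0 -rowE -/u hZl hDr hZr mulrDr mulrA ac => /eqP.
  by rewrite -subr_eq0 addrAC subrr add0r mulf_eq0 (negPf a0) => /eqP.
have hbu := h_ker b bN; have hdu := h_ker d dN.
pose l := (<[b]> + <[d]>)%VS.
have memP x : (x \in l) = (h x u == 0) by rewrite (mem_polar x ibd u0 hbu hdu).
have persp : perspectivity iota sigma <[u]>%VS l.
  split; [exact: is_point_line | exact: is_line_span2 | |].
    move=> m _; rewrite -memvE => um; apply: collineation_stable => x xm.
    by rewrite AE xN memvD // memvZ.
  move=> Q /is_pointP[w w0 ->]; rewrite -memvE => /mem_line2[x [y ->]].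
  apply: (@collineation_eigen _ _ _ _ a).
  by rewrite mulmxDl -!scalemxAl bA dA scalerDr !scalerA !(mulrC a).
have pp := pole_polar_line u0 ru ibd rb rd hbu hdu.
have [huu|huu] := eqVneq (h u u) 0.
  right; split.
    (* An isotropic center lies on its own polar line, the axis; this makes [N] square to zero. *)
    have uN : u *m N = 0.
      have /mem_line2[x [y ->]] : u \in l by rewrite memP huu.
      by rewrite mulmxDl -!scalemxAl bN dN !scaler0 addr0.
    apply: (@order_eq_p a 2); first exact: prime_gt1.
    apply/row_matrixP => i; rewrite rowE row0 expr2 -mulmxE mulmxA.
    rewrite -/N (xN (delta_mx 0 i)).
    by rewrite -/u -scalemxAl uN scaler0.
  exists <[u]>%VS, l; split=> //; last exact: tangent_polar u0 ru huu _ rb rd _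
    _.
    by split=> //; rewrite -memvE memP huu.
  exact/on_hermitian_line.
left; split.
  (* A center that is not isotropic is a third independent eigenvector, and both eigenvalues have
     [q.+1]-th power [c]. *)
  have [mu uA] : exists mu, u *m A = mu *: u.
    by rewrite AE xN -scalerDl; eexists.
  have mc := eigenvalue_pair uA uA huu.
  apply: (order_dvd_eigenvalues (s := c) (indep3_extend ibd hbu hdu huu) bA dA
    uA).
  - by rewrite exprS ac.
  - by rewrite exprS ac.
  by rewrite exprS mc.
exists <[u]>%VS, l; split=> //; last exact: chord_polar u0 ru huu _ rb rd _ _.
  by split=> //; rewrite -memvE memP.
split; first exact: is_point_line.
by move=> /(on_hermitian_line u0)/eqP; apply/negP.
Qed.

(** * Jordan blocks of size two and three *)

Lemma p_dvd_q : (p %| q)%N.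
Proof. by rewrite (dvdn_pcharf pcharK) q_eq0. Qed.

Lemma p_ndvd_q2_minus1 : ~~ (p %| q ^ 2 - 1)%N.
Proof.
apply: contraL (prime_gt1 p_pr) => pd.
rewrite -leqNgt dvdn_leq // -(subKn (_ : (1 <= q ^ 2)%N)) ?expn_gt0 ?q_gt0 //.
by rewrite dvdn_sub // dvdn_exp // p_dvd_q.
Qed.

(** The similitude identity on [u] and [t] is a triangular system for the four values of [h]. If
    [a * a ^+ q] differed from [c], the span of [u] and [t] would be totally isotropic; once they
    agree, the equation for [h u t] leaves [a * h u u = 0]. *)
Lemma jordan_block_isotropic (a : K) u t : u != 0 -> u *m A = a *: u ->
  t *m A = a *: t + u -> a * a ^+ q = c /\ h u u = 0.
Proof.
move=> u0 uA tA; have iut : indep2 u t.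
  move=> x y E; have := congr1 (mulmx^~ A) E.
  rewrite mulmxDl -!scalemxAl uA tA mul0mx scalerDr addrA !scalerA !(mulrC _ a).
  rewrite -!scalerA -scalerDr E scaler0 add0r => /eqP.
  rewrite scaler_eq0 (negPf u0) orbF => /eqP y0; split=> //; move/eqP: E.
  by rewrite y0 scale0r addr0 scaler_eq0 (negPf u0) orbF => /eqP.
have a0 := eigenvalue_neq0 u0 uA.
have huu : a * a ^+ q * h u u = c * h u u by rewrite -hA uA hZl hZr mulrA.
have hut : a * a ^+ q * h u t + a * h u u = c * h u t.
  by rewrite -hA uA tA hZl hDr hZr mulrDr mulrA.
have htu : a * a ^+ q * h t u + a ^+ q * h u u = c * h t u.
  by rewrite -hA uA tA hZr hDl hZl mulrDr mulrA (mulrC a).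
have htt : a * a ^+ q * h t t + a * h t u + a ^+ q * h u t + h u u = c * h t t.
  by rewrite -hA tA !hlinE; ring.
have ac : a * a ^+ q = c.
  apply/eqP/negPn/negP => ac.
  have z (x : K) : a * a ^+ q * x = c * x -> x = 0.
    move/eqP; rewrite -subr_eq0 -mulrBl mulf_eq0 subr_eq0 (negPf ac).
    by move/eqP.
  move: hut htu htt; rewrite (z _ huu) !mulr0 !addr0 => /z hut /z htu.
  rewrite hut htu !mulr0 !addr0 => /z htt.
  by have := not_totally_isotropic iut; rewrite (z _ huu) hut htu htt eqxx.
split=> //; move/eqP: hut; rewrite ac -subr_eq0 addrAC subrr add0r.
by rewrite mulf_eq0 (negPf a0) => /eqP.
Qed.

(** The Frobenius map preserves the eigenspace, which is a single point, so this point is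
    rational. *)
Lemma rational_eigenvector (a : K) v : v != 0 -> v *m A = a *: v ->
    a ^+ (q ^ 2) = a -> (forall x, x *m A = a *: x -> exists b, x = b *: v) ->
  exists w b, [/\ w != 0, rational w, w = b *: v & w *m A = a *: w].
Proof.
move=> v0 vA aq uniq; have [b fv] := uniq _ (frob_eigenvector1 vA aq).
have [w [w0 rw]] := frob_stable_point (pcharK_q_power 2) v0 fv.
move=> E; have /vlineP[d wE] : w \in <[v]>%VS by rewrite E memv_line.
by exists w, d; split=> //; rewrite wE -scalemxAl vA !scalerA mulrC.
Qed.

Lemma simple_jordan_case (a b : K) t u w : a != b -> u != 0 -> w != 0 ->
  t *m A = a *: t + u -> u *m A = a *: u -> w *m A = b *: w ->
  case_E iota p q M sigma.
Proof.
move=> ab u0 w0 tA uA wA.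
have [ac huu] := jordan_block_isotropic u0 uA tA.
have ab0 : a - b != 0 by rewrite subr_eq0.
have a0 := eigenvalue_neq0 u0 uA; have b0 := eigenvalue_neq0 w0 wA.
have tN d : t *m (A - d%:M) = (a - d) *: t + u.
  by rewrite mulmxBr tA mul_mx_scalar scalerBl addrAC.
have uN d : u *m (A - d%:M) = (a - d) *: u.
  by rewrite mulmxBr uA mul_mx_scalar scalerBl.
have wN d : w *m (A - d%:M) = (b - d) *: w.
  by rewrite mulmxBr wA mul_mx_scalar scalerBl.
have ituw : indep3 t u w.
  move=> x y z E.
  have E1 : x *: u + (z * (b - a)) *: w = 0.
    have := congr1 (mulmx^~ (A - a%:M)) E.
    rewrite !mulmxDl -!scalemxAl tN uN wN subrr !scale0r add0r scaler0 addr0.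
    by rewrite mul0mx scalerA.
  have := congr1 (mulmx^~ (A - a%:M)) E1.
  rewrite mulmxDl -!scalemxAl uN wN subrr scale0r scaler0 add0r mul0mx scalerA.
  move/eqP; rewrite scaler_eq0 (negPf w0) orbF -mulrA !mulf_eq0 orbb.
  rewrite -[b - a]opprB oppr_eq0 (negPf ab0) orbF => /eqP z0.
  move/eqP: E1; rewrite z0 mul0r scale0r addr0 scaler_eq0 (negPf u0) orbF.
  move=> /eqP x0; split=> //; move/eqP: E.
  by rewrite x0 z0 !scale0r add0r addr0 scaler_eq0 (negPf u0) orbF => /eqP.
(* A nonzero [h u w] or [h t w] would pair [a] with [b]; since [a] is paired with itself this would
   force [a = b]. *)
have hww : h w w != 0.
  have := h_basis_neq0 ituw w0; have [huw|huw] := eqVneq (h u w) 0; last first.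
    have := eigenvalue_pair uA wA huw; rewrite -ac => /(mulfI a0)/frob_inj ba.
    by rewrite ba eqxx in ab.
  case/orP=> // htw; have : a * b ^+ q * h t w = c * h t w.
    by rewrite -hA tA wA !hlinE huw addr0; ring.
  move/(mulIf htw); rewrite -ac => /(mulfI a0)/frob_inj ba.
  by rewrite ba eqxx in ab.
have bc := eigenvalue_pair wA wA hww.
have [aq bq] := (eigenvalue_rational ac, eigenvalue_rational bc).
have au x : x *m A = a *: x -> exists d, x = d *: u.
  have [r [s [z ->]]] := indep3_basis x ituw => xA.
  have : r *: u + (z * (b - a)) *: w = 0.
    have : (r *: t + s *: u + z *: w) *m (A - a%:M) = 0.
      by rewrite mulmxBr xA mul_mx_scalar subrr.
    rewrite !mulmxDl -!scalemxAl tN uN wN subrr.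
    by rewrite !scale0r add0r scaler0 addr0 scalerA.
  have := ituw 0 r (z * (b - a)); rewrite scale0r add0r => /[apply].
  case=> _ r0 /eqP; rewrite mulf_eq0 -[b - a]opprB oppr_eq0 (negPf ab0) orbF.
  by move/eqP->; exists s; rewrite r0 !scale0r add0r addr0.
have bw x : x *m A = b *: x -> exists d, x = d *: w.
  have [r [s [z ->]]] := indep3_basis x ituw => xA.
  have : (r * (a - b)) *: t + (r + s * (a - b)) *: u + 0 *: w = 0.
    have : (r *: t + s *: u + z *: w) *m (A - b%:M) = 0.
      by rewrite mulmxBr xA mul_mx_scalar subrr.
    rewrite !mulmxDl -!scalemxAl tN uN wN subrr.
    by rewrite !scale0r scaler0 !addr0 scalerDr !scalerA scalerDl addrA.
  case/ituw=> /eqP; rewrite mulf_eq0 (negPf ab0) orbF => /eqP-> /eqP.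
  rewrite add0r mulf_eq0 (negPf ab0) orbF => /eqP-> _.
  by exists z; rewrite !scale0r !add0r.
(* At [k = 0] the truncated exponent [k.-1] is harmless, since the factor [k%:R] vanishes. *)
have tk k : t *m A ^+ k = a ^+ k *: t + (k%:R * a ^+ k.-1) *: u.
  elim: k => [|k IHk]; first by rewrite !expr0 mulmx1 mul0r scale1r scale0r
    addr0.
  rewrite exprSr -mulmxE mulmxA IHk mulmxDl -!scalemxAl tA uA scalerDr !scalerA.
  rewrite -addrA -scalerDl -exprSr; congr (_ + _ *: _).
  rewrite -natr1 mulrDl mul1r addrC; congr (_ + _).
  by case: k {IHk} => [|k] /=; rewrite ?mul0r // -mulrA -exprSr.
(* For a scalar power of [A] the coefficient at [u] vanishes, so the exponent is zero in [K]. *)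
have p_ord : (p %| #[sigma]%g)%N.
  have /(order_dvdP iota)[s As] := dvdnn #[sigma]%g.
  have := tk #[sigma]%g; rewrite As mul_mx_scalar => /eqP.
  rewrite -subr_eq0 opprD addrA -scalerBl -scaleNr => /eqP E.
  have [|_ + _] := ituw (s - a ^+ #[sigma]%g) (- (#[sigma]%g%:R * a ^+
    #[sigma]%g.-1)) 0.
    by rewrite scale0r addr0.
  move/eqP; rewrite oppr_eq0 mulf_eq0 expf_eq0 (negPf a0) andbF orbF.
  by rewrite (dvdn_pcharf pcharK).
have exp1 (x : K) : x != 0 -> x ^+ (q ^ 2) = x -> x ^+ (q ^ 2 - 1) = 1.
  move=> x0 xq; apply: (mulIf x0); rewrite -exprSr mul1r subn1 prednK //.
  by rewrite expn_gt0 q_gt0.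
(* The factor [p] removes the nilpotent part, and [q ^ 2 - 1] sends both eigenvalues to 1. *)
have ord_dvd : (#[sigma]%g %| p * (q ^ 2 - 1))%N.
  apply/(order_dvdP iota); exists 1; apply: (mx_eq_on_basis ituw).
  - rewrite tk mulnC natrM (pcharf0 pcharK) mulr0 mul0r scale0r addr0 exprM.
    by rewrite exp1 // expr1n scale1r mulmx1.
  - by rewrite (eigenvector_expr _ uA) mulnC exprM exp1 // expr1n scale1r
    mulmx1.
  by rewrite (eigenvector_expr _ wA) mulnC exprM exp1 // expr1n scale1r mulmx1.
split=> //.
- apply: contra p_ndvd_q2_minus1 => /dvdn_trans/(_ ord_dvd).
  by rewrite -mulnn dvdn_pmul2l // prime_gt0.
(* If the order were [p], the eigenvalues would have equal [p]-th powers and hence coincide. *)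
- move=> ordp; have /(order_dvdP iota)[s] := dvdnn #[sigma]%g.
  rewrite ordp => As; case/eqP: ab; apply: (fmorph_inj (pFrobenius_aut pcharK)).
  rewrite -[LHS]/(a ^+ p) -[RHS]/(b ^+ p) (eigenvalue_expr_scalar u0 uA As).
  by rewrite (eigenvalue_expr_scalar w0 wA As).
have [u' [x [u'0 ru u'E u'A]]] := rational_eigenvector u0 uA aq au.
have [w' [y [w'0 rw w'E w'A]]] := rational_eigenvector w0 wA bq bw.
exists <[u']>%VS, <[w']>%VS; split.
- exact: collineation_eigen u'A.
- exact: collineation_eigen w'A.
- split; first exact: rational_point.
  by apply/(on_hermitian_line u'0); rewrite u'E hZl hZr huu !mulr0.
split; first exact: rational_point.
move=> /(on_hermitian_line w'0)/eqP.
have y0 : y != 0 by apply: contraNneq w'0; rewrite w'E => ->; rewrite scale0r.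
by rewrite w'E hZl hZr !mulf_eq0 expf_eq0 q_gt0 (negPf y0) (negPf hww).
Qed.

Lemma polar_stable (a : K) u b d : u != 0 -> u *m A = a *: u -> indep2 b d ->
    h b u = 0 -> h d u = 0 ->
  collineation iota sigma (<[b]> + <[d]>)%VS = (<[b]> + <[d]>)%VS.
Proof.
move=> u0 uA ibd hbu hdu; apply: collineation_stable => x.
rewrite !(mem_polar _ ibd u0) // => /eqP hxu; have := hA x u.
rewrite uA hZr hxu mulr0 => /eqP; rewrite mulf_eq0 expf_eq0 q_gt0.
by rewrite (negPf (eigenvalue_neq0 u0 uA)).
Qed.

(** A Jordan chain [v], [t], [u] fills the space, so the only fixed point is the one spanned by [u];
    it is therefore rational, and it is isotropic. *)
Lemma full_jordan_case (a : K) :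
  (A - a%:M) ^+ 3 = 0 -> (A - a%:M) ^+ 2 != 0 -> case_D iota p q M sigma.
Proof.
set N := A - a%:M => N3 N2.
have AE x : x *m A = a *: x + x *m N.
  by rewrite mulmxBr mul_mx_scalar addrC subrK.
have NN x : x *m N *m N = x *m N ^+ 2 by rewrite -mulmxA expr2 mulmxE.
have NNN x : x *m N ^+ 2 *m N = 0.
  by rewrite -mulmxA [N ^+ 2 *m N](_ : _ = N ^+ 3) ?N3 ?mulmx0 // mulmxE
    -exprSr.
have [i ri] := exists_row_neq0 N2.
move: ri; rewrite rowE; move: (delta_mx 0 i) => v u0.
set u := v *m N ^+ 2 in u0; pose t := v *m N.
have uA : u *m A = a *: u by rewrite AE NNN addr0.
have tA : t *m A = a *: t + u by rewrite AE NN.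
have [ac huu] := jordan_block_isotropic u0 uA tA.
have ivtu : indep3 v t u.
  move=> x y z E; have E1 : x *: t + y *: u = 0.
    have := congr1 (mulmx^~ N) E.
    by rewrite !mulmxDl -!scalemxAl NN NNN scaler0 addr0 mul0mx.
  have /eqP := congr1 (mulmx^~ N) E1; rewrite mulmxDl -!scalemxAl NN NNN.
  rewrite scaler0 addr0 mul0mx scaler_eq0 (negPf u0) orbF => /eqP x0.
  move/eqP: E1; rewrite x0 scale0r add0r scaler_eq0 (negPf u0) orbF => /eqP y0.
  move/eqP: E; rewrite x0 y0 !scale0r !add0r scaler_eq0 (negPf u0) orbF.
  by move/eqP.
have au x : x *m A = a *: x -> exists d, x = d *: u.
  have [r [s [z ->]]] := indep3_basis x ivtu => xA.
  have : (r *: v + s *: t + z *: u) *m N = 0.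
    by rewrite mulmxBr xA mul_mx_scalar subrr.
  rewrite !mulmxDl -!scalemxAl NN NNN scaler0 addr0.
  rewrite -[r *: _]add0r -{1}(scale0r v) => /ivtu[_ -> ->].
  by exists z; rewrite !scale0r !add0r.
have [u' [x [u'0 ru u'E u'A]]] :=
  rational_eigenvector u0 uA (eigenvalue_rational ac) au.
have hu' : h u' u' = 0 by rewrite u'E hZl hZr huu !mulr0.
have [b [d [ibd hbu hdu rbd]]] := polar_basis u'0.
have [rb rd] := rbd ru; split.
  have [p2|p2] := eqVneq p 2%N; [right | left].
    split=> //; have : (#[sigma]%g %| p ^ 2)%N.
      by apply: (@order_dvd_p_power a); rewrite p2 exprS N3 mulr0.
    case/(dvdn_pfactor _ _ p_pr) => -[|[|[|//]]] _; rewrite p2.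
    - by move=> o1; have := order_neq1; rewrite o1.
    (* With order 2 in characteristic 2, [N ^+ 2] would be scalar; as it kills [u], it would be
       zero. *)
    - move=> o2; have /(order_dvdP iota)[s] := dvdnn #[sigma]%g.
      rewrite o2 -[in X in A ^+ X]p2 -[p in A ^+ p]expn1 (expr_nilpotent_part
        a).
      rewrite expn1 p2 -/N => As; case/eqP: N2.
      have NS : N ^+ 2 = (s - a ^+ 2)%:M by rewrite raddfB /= -As addrC addKr.
      have /eqP : (s - a ^+ 2) *: u = 0.
        by rewrite -mul_mx_scalar -NS -NN NNN mul0mx.
      by rewrite scaler_eq0 (negPf u0) orbF => /eqP s0; rewrite NS s0 raddf0.
    by [].
  split; last exact/eqP.
  apply: (@order_eq_p a 3) N3.
  by have := prime_gt1 p_pr; rewrite leq_eqVlt eq_sym (negPf p2).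
exists <[u']>%VS, (<[b]> + <[d]>)%VS; split.
- split; first exact: collineation_eigen u'A.
  exact: polar_stable u'A ibd hbu hdu.
- by split; [exact: rational_point | exact/on_hermitian_line].
- exact: tangent_polar u'0 ru hu' ibd rb rd hbu hdu.
exact: pole_polar_line.
Qed.

(** * Three distinct eigenvalues and the fixed triangle *)

Lemma eigen_coef1 u v w (x y z r s t : K) : u != 0 ->
    u *m A = x *: u -> v *m A = y *: v -> w *m A = z *: w ->
  x != y -> x != z -> r *: u + s *: v + t *: w = 0 -> r = 0.
Proof.
move=> u0 uA vA wA xy xz E; apply/eqP.
have eN (b d : K) (m : 'rV[K]_3) : m *m A = b *: m -> m *m (A - d%:M) = (b - d)
  *: m.
  by move=> mA; rewrite mulmxBr mA mul_mx_scalar scalerBl.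
(* The two shifts annihilate the terms in [w] and [v] and multiply the one in [u] by a nonzero
   scalar. *)
have := congr1 (fun m => m *m (A - z%:M) *m (A - y%:M)) E.
rewrite !mulmxDl -!scalemxAl !(eN _ _ _ uA, eN _ _ _ vA, eN _ _ _ wA).
rewrite -!scalemxAl !(eN _ _ _ uA, eN _ _ _ vA, eN _ _ _ wA) !subrr.
rewrite !mul0mx !scale0r !scaler0 !addr0 !scalerA => /eqP.
by rewrite scaler_eq0 (negPf u0) orbF !mulf_eq0 !subr_eq0 (negPf xy) (negPf xz)
  !orbF.
Qed.

Definition eigen_triple (x y z : K) u v w : Prop :=
  [/\ [/\ u != 0, v != 0 & w != 0],
      [/\ u *m A = x *: u, v *m A = y *: v & w *m A = z *: w]
    & [/\ x != y, y != z & x != z]].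

Lemma eigen_triple_rotate (x y z : K) u v w :
  eigen_triple x y z u v w -> eigen_triple y z x v w u.
Proof.
by case=> [[u0 v0 w0] [uA vA wA] [xy yz xz]]; split; split; rewrite // eq_sym.
Qed.

Lemma eigen_triple_swap (x y z : K) u v w :
  eigen_triple x y z u v w -> eigen_triple x z y u w v.
Proof.
by case=> [[u0 v0 w0] [uA vA wA] [xy yz xz]]; split; split; rewrite // eq_sym.
Qed.

Lemma eigen_triple_indep (x y z : K) u v w :
  eigen_triple x y z u v w -> indep3 u v w.
Proof.
case=> [[u0 v0 w0] [uA vA wA] [xy yz xz]] r s t E.
have E' : s *: v + t *: w + r *: u = 0 by rewrite addrC addrA.
have E'' : t *: w + r *: u + s *: v = 0 by rewrite addrC addrA.
have [yx zy zx] : [/\ y != x, z != y & z != x] by split; rewrite eq_sym.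
split; [exact: eigen_coef1 u0 uA vA wA xy xz E
       | exact: eigen_coef1 v0 vA wA uA yz yx E'
       | exact: eigen_coef1 w0 wA uA vA zx zy E''].
Qed.

Lemma eigen_triple_unique (x y z : K) u v w m : eigen_triple x y z u v w ->
  m *m A = x *: m -> exists b, m = b *: u.
Proof.
move=> e3 mA; have i3 := eigen_triple_indep e3.
case: e3 => [[u0 v0 w0] [uA vA wA] [xy yz xz]].
have [r [s [t mE]]] := indep3_basis m i3.
have : m *m (A - x%:M) = 0 by rewrite mulmxBr mA mul_mx_scalar subrr.
rewrite mE !mulmxDl -!scalemxAl !mulmxBr uA vA wA !mul_mx_scalar -!scalerBl.
rewrite subrr scale0r scaler0 add0r !scalerA => E.
have [|_ /eqP s0 /eqP t0] := i3 0 (s * (y - x)) (t * (z - x)).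
  by rewrite scale0r add0r.
move: s0 t0; rewrite !mulf_eq0 !subr_eq0 [y == x]eq_sym [z == x]eq_sym.
rewrite (negPf xy) (negPf xz) !orbF => /eqP-> /eqP->.
by exists r; rewrite !scale0r !addr0.
Qed.

Lemma eigen_triple_rational (x y z : K) u v w : eigen_triple x y z u v w ->
    x ^+ (q ^ 2) = x ->
  exists2 u', rational u' & eigen_triple x y z u' v w.
Proof.
move=> e3 xq; case: (e3) => [[u0 v0 w0] [uA vA wA] ne].
have [|u' [_ [u'0 ru _ u'A]]] := rational_eigenvector u0 uA xq.
  by move=> m; apply: eigen_triple_unique e3.
by exists u'.
Qed.

Lemma eigen_triple_rational3 (x y z : K) u v w : eigen_triple x y z u v w ->
    x ^+ (q ^ 2) = x -> y ^+ (q ^ 2) = y -> z ^+ (q ^ 2) = z ->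
  exists u' v' w', eigen_triple x y z u' v' w' /\
    [/\ rational u', rational v' & rational w'].
Proof.
move=> e3 xq yq zq.
have [u' ru /eigen_triple_rotate e3u] := eigen_triple_rational e3 xq.
have [v' rv /eigen_triple_rotate e3v] := eigen_triple_rational e3u yq.
have [w' rw /eigen_triple_rotate e3w] := eigen_triple_rational e3v zq.
by exists u', v', w'.
Qed.

Lemma eigen_triple_triangle (x y z : K) u v w : eigen_triple x y z u v w ->
  non_degenerate_triangle <[u]>%VS <[v]>%VS <[w]>%VS /\
  [/\ collineation iota sigma <[u]>%VS = <[u]>%VS,
      collineation iota sigma <[v]>%VS = <[v]>%VS
    & collineation iota sigma <[w]>%VS = <[w]>%VS].
Proof.
move=> e3; have full := indep3_full (eigen_triple_indep e3).
case: e3 => [[u0 v0 w0] [uA vA wA] _]; split.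
  by split=> //; apply: is_point_line.
by split; [exact: collineation_eigen uA | exact: collineation_eigen vA
          | exact: collineation_eigen wA].
Qed.

Lemma not_on_hermitian v : v != 0 -> h v v != 0 -> ~ on_hermitian iota q M
  <[v]>%VS.
Proof. by move=> v0 hvv /(on_hermitian_line v0)/eqP; apply/negP. Qed.

Lemma pair_inj (x y z : K) : x * z ^+ q = c -> y * z ^+ q = c -> x = y.
Proof.
move=> xc; have z0 : z ^+ q != 0.
  by apply: contraNneq c_neq0 => z0; rewrite -xc z0 mulr0.
by rewrite -xc => /(mulIf z0).
Qed.

(** Each eigenvalue has a unique partner, so eigenvectors for unpaired eigenvalues are
    orthogonal. *)
Lemma h_eigen_eq0 (x y z : K) u v : x * z ^+ q = c -> y != x ->
  u *m A = y *: u -> v *m A = z *: v -> h u v = 0.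
Proof.
move=> xz yx uA vA; apply/eqP; apply: contraR yx => huv.
by apply/eqP; apply: (pair_inj (eigenvalue_pair uA vA huv) xz).
Qed.

Lemma h_eigen_triple_neq0 (x y z : K) u v w : eigen_triple x y z u v w ->
  h u v = 0 -> h w v = 0 -> h v v != 0.
Proof.
move=> e3 huv hwv; have := h_basis_neq0 (eigen_triple_indep e3).
by case: e3 => [[_ v0 _] _ _] => /(_ _ v0); rewrite huv hwv eqxx orbF.
Qed.

Lemma coprime_dvdn_p d m : (d %| m)%N -> ~~ (p %| m)%N -> coprime d p.
Proof. by move=> dm pm; rewrite coprime_sym prime_coprime //; apply: contra pm
  => /dvdn_trans->. Qed.

(** Self-paired eigenvalues are rational, and their eigenvectors form an orthogonal basis. The
    common value [c] of the [q.+1]-th powers bounds the order. *)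
Lemma triangle_case_fixed (x y z : K) u v w : eigen_triple x y z u v w ->
  x * x ^+ q = c -> y * y ^+ q = c -> z * z ^+ q = c -> case_B iota p q M sigma.
Proof.
move=> e3 xc yc zc.
have [u' [v' [w' [{u v w e3}e3 [ru rv rw]]]]] := eigen_triple_rational3 e3
  (eigenvalue_rational xc) (eigenvalue_rational yc) (eigenvalue_rational zc).
have i3 := eigen_triple_indep e3.
have [tri fixT] := eigen_triple_triangle e3.
case: (e3) => [[u0 v0 w0] [uA vA wA] [xy yz xz]].
have [yx zy zx] : [/\ y != x, z != y & z != x] by split; rewrite eq_sym.
have huv := h_eigen_eq0 yc xy uA vA; have huw := h_eigen_eq0 zc xz uA wA.
have hvu := h_eigen_eq0 xc yx vA uA; have hvw := h_eigen_eq0 zc yz vA wA.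
have hwu := h_eigen_eq0 xc zx wA uA; have hwv := h_eigen_eq0 yc zy wA vA.
have hvv := h_eigen_triple_neq0 e3 huv hwv.
have hww := h_eigen_triple_neq0 (eigen_triple_rotate e3) hvw huw.
have huu := h_eigen_triple_neq0 (eigen_triple_rotate (eigen_triple_rotate e3))
  hwu hvu.
have ordq : (#[sigma]%g %| q.+1)%N.
  by apply: (order_dvd_eigenvalues i3 uA vA wA (s := c)); rewrite exprS.
split.
  apply: coprime_dvdn_p ordq _; apply: contraL (prime_gt1 p_pr) => pq.
  by rewrite -leqNgt dvdn_leq // -(@dvdn_addr q) ?p_dvd_q // addn1.
exists <[u']>%VS, <[v']>%VS, <[w']>%VS; split=> //; constructor 1; split=> //.
- by split; apply: rational_point.
- by split; apply: not_on_hermitian.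
have i2 a b : a != 0 -> b != 0 -> h a a != 0 -> h b a = 0 -> indep2 b a.
  move=> a0 b0 haa hba r s E; have : s = 0.
    have /eqP := congr1 (h^~ a) E; rewrite !hlinE hba mulr0 add0r h0l mulf_eq0.
    by rewrite (negPf haa) orbF => /eqP.
  move=> s0; split=> //; move/eqP: E.
  by rewrite s0 scale0r addr0 scaler_eq0 (negPf b0) orbF => /eqP.
by split; apply: pole_polar_line => //; apply: i2.
Qed.

(** Exchanging [y] and [z] makes [v] and [w] isotropic. All three eigenvalues are still rational,
    because the square of the pairing is trivial. *)
Lemma triangle_case_transposed (x y z : K) u v w : eigen_triple x y z u v w ->
  x * x ^+ q = c -> y * z ^+ q = c -> z * y ^+ q = c -> case_B iota p q M sigma.
Proof.
have rat2 a b : a * b ^+ q = c -> b * a ^+ q = c -> a ^+ (q ^ 2) = a.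
  move=> ab ba; have b0 : b != 0 by apply: contraNneq c_neq0 => b0; rewrite -ba
    b0 mul0r.
  have := c_frob; rewrite -{1}ba exprMn frob2 -ab mulrC.
  by apply/mulIf/expf_neq0.
move=> e3 xc yz zy; have [xq yq zq] := And3 (eigenvalue_rational xc) (rat2 _ _
  yz zy) (rat2 _ _ zy yz).
have [u' [v' [w' [{u v w e3}e3 [ru rv rw]]]]] :=
  eigen_triple_rational3 e3 xq yq zq.
have i3 := eigen_triple_indep e3.
have [tri fixT] := eigen_triple_triangle e3.
case: (e3) => [[u0 v0 w0] [uA vA wA] [nxy nyz nxz]].
have [nyx nzy nzx] : [/\ y != x, z != y & z != x] by split; rewrite eq_sym.
have hvv := h_eigen_eq0 zy nyz vA vA; have hww := h_eigen_eq0 yz nzy wA wA.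
have hvu := h_eigen_eq0 xc nyx vA uA; have hwu := h_eigen_eq0 xc nzx wA uA.
have huu := h_eigen_triple_neq0 (eigen_triple_rotate (eigen_triple_rotate e3))
  hwu hvu.
have exp1 (a : K) (m : 'rV[K]_3) : a ^+ (q ^ 2) = a -> m != 0 -> m *m A = a *:
  m ->
    a ^+ (q ^ 2 - 1) = 1.
  move=> aq m0 mA; apply: (mulIf (eigenvalue_neq0 m0 mA)).
  by rewrite -exprSr mul1r subn1 prednK ?expn_gt0 ?q_gt0.
have ordq : (#[sigma]%g %| q ^ 2 - 1)%N.
  apply: (order_dvd_eigenvalues i3 uA vA wA (s := 1)).
  - exact: exp1 xq u0 uA.
  - exact: exp1 yq v0 vA.
  exact: exp1 zq w0 wA.
split; first exact: coprime_dvdn_p ordq p_ndvd_q2_minus1.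
exists <[u']>%VS, <[v']>%VS, <[w']>%VS; split=> //; constructor 2; split=> //.
- by split; apply: rational_point.
- by split; [exact: not_on_hermitian | exact/on_hermitian_line |
  exact/on_hermitian_line].
(* A scalar [A ^+ q.+1] would give [y] the [q.+1]-th power [c] of [x], making [y] its own
   partner. *)
apply/negP => /(order_dvdP iota)[s As]; case/eqP: nyz.
apply: (@pair_inj _ _ y) zy.
by rewrite -exprS (eigenvalue_expr_scalar v0 vA As) -(eigenvalue_expr_scalar u0
  uA As) exprS.
Qed.

(** The Frobenius map of order [q ^ 2] permutes the eigenvalues cyclically, so its cube fixes them
    and their points. The power [q ^ 2 - q + 1] of each is the symmetric expression
    [x * y * z / c]. *)
Lemma triangle_case_cyclic (x y z : K) u v w : eigen_triple x y z u v w ->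
  y * x ^+ q = c -> z * y ^+ q = c -> x * z ^+ q = c -> case_B iota p q M sigma.
Proof.
have cyc a b d : b * a ^+ q = c -> d * b ^+ q = c -> a ^+ (q ^ 2) = d.
  move=> ba db; have b0 : b != 0 by apply: contraNneq c_neq0 => b0; rewrite -ba
    b0 mul0r.
  have := c_frob; rewrite -{1}ba exprMn frob2 -db mulrC.
  by apply/mulIf/expf_neq0.
move=> e3 yx zy xz.
have [xq yq zq] := And3 (cyc _ _ _ yx zy) (cyc _ _ _ zy xz) (cyc _ _ _ xz yx).
have point a b d a' b' d' : eigen_triple a b d a' b' d' ->
    b * a ^+ q = c -> d * b ^+ q = c -> a * d ^+ q = c ->
  [/\ PG2_point (q ^ 6) <[a']>%VS, ~ PG2_point (q ^ 2) <[a']>%VS,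
      on_hermitian iota q M <[a']>%VS & a ^+ (q ^ 2 - q + 1) = a * b * d / c].
  move=> t3 ba db ad; case: (t3) => [[a'0 _ _] [aA _ _] [ab bd ad']].
  split.
  - have a6 : a ^+ ((q ^ 2) ^ 3) = a.
      rewrite (expnS (q ^ 2) 2) (expnS (q ^ 2) 1) expn1 !(exprM _ (q ^ 2)).
      by rewrite (cyc _ _ _ ba db) (cyc _ _ _ ad ba) (cyc _ _ _ db ad).
    have [k fa] : exists k, frob_mx (q ^ 6) a' = k *: a'.
      apply: (eigen_triple_unique t3); have := frob_eigenvector 3 aA.
      by rewrite a6 -expnM.
    have [w' [w'0 rw ->]] := frob_stable_point (pcharK_q_power 6) a'0 fa.
    exact: rational_point.
  (* A rational eigenvector would also belong to the Frobenius conjugate of its eigenvalue, which is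
     different. *)
  - move=> /rational_pointP[w' [w'0 rw E]].
    have /vlineP[k w'E] : w' \in <[a']>%VS by rewrite E memv_line.
    have wA : w' *m A = a *: w'.
      by rewrite w'E -scalemxAl aA !scalerA mulrC.
    have := frob_eigenvector 1 wA; rewrite expn1 rw wA (cyc _ _ _ ba db) =>
      /eqP.
    by rewrite -subr_eq0 -scalerBl scaler_eq0 (negPf w'0) orbF subr_eq0 (negPf
      ad').
  - by apply/on_hermitian_line => //; exact: (h_eigen_eq0 ba ab aA aA).
  (* By [b * a ^+ q = c], multiplying by [c] gives [a ^+ (q ^ 2) * a * b]. *)
  apply: (mulIf c_neq0); rewrite divfK ?c_neq0 // -{1}ba mulrCA mulrC -exprD.
  rewrite addnAC subnK; last by rewrite -{1}(expn1 q) leq_pexp2l ?q_gt0.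
  by rewrite exprD expr1 (cyc _ _ _ ba db); ring.
have i3 := eigen_triple_indep e3; have [tri fixT] := eigen_triple_triangle e3.
have e3' := eigen_triple_rotate e3; have e3'' := eigen_triple_rotate e3'.
have [u6 u2 uH xN] := point _ _ _ _ _ _ e3 yx zy xz.
have [v6 v2 vH yN] := point _ _ _ _ _ _ e3' zy xz yx.
have [w6 w2 wH zN] := point _ _ _ _ _ _ e3'' xz yx zy.
case: e3 => _ [uA vA wA] _.
have ordq : (#[sigma]%g %| q ^ 2 - q + 1)%N.
  apply: (order_dvd_eigenvalues i3 uA vA wA xN).
    by rewrite yN; congr (_ / _); ring.
  by rewrite zN; congr (_ / _); ring.
split.
  apply: coprime_dvdn_p ordq _; apply: contraL (prime_gt1 p_pr) => pq.
  rewrite -leqNgt dvdn_leq // -(@dvdn_addr (q ^ 2 - q)) //.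
  by rewrite dvdn_sub ?p_dvd_q // dvdn_exp ?p_dvd_q.
by exists <[u]>%VS, <[v]>%VS, <[w]>%VS; split=> //; constructor 3.
Qed.

Lemma triangle_case (x y z : K) u v w : eigen_triple x y z u v w ->
  case_B iota p q M sigma.
Proof.
move=> e3; case: (e3) => [[u0 v0 w0] [uA vA wA] [xy yz xz]].
have i3 := eigen_triple_indep e3.
have pairs (m : 'rV[K]_3) (a : K) : m != 0 -> m *m A = a *: m ->
    [\/ x * a ^+ q = c, y * a ^+ q = c | z * a ^+ q = c].
  move=> m0 mA; case/or3P: (h_basis_neq0 i3 m0).
  - by constructor 1; apply: eigenvalue_pair uA mA _.
  - by constructor 2; apply: eigenvalue_pair vA mA _.
  by constructor 3; apply: (eigenvalue_pair wA mA).
have inj a b d : a * b ^+ q = c -> a * d ^+ q = c -> b = d.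
  move=> ab ad; have a0 : a != 0.
    by apply: contraNneq c_neq0 => a0; rewrite -ab a0 mul0r.
  by apply/frob_inj/(mulfI a0); rewrite ab ad.
have absurd a b d : a * b ^+ q = c -> a * d ^+ q = c -> b != d -> case_B iota p
  q M sigma.
  by move=> ab ad; rewrite (inj _ _ _ ab ad) eqxx.
have r3 := eigen_triple_rotate e3; have rr3 := eigen_triple_rotate r3.
(* Of the 27 choices of partners, injectivity leaves the six permutations. *)
case: (pairs u x u0 uA) (pairs v y v0 vA) (pairs w z w0 wA) => X [] Y [] Z;
  try solve [exact: (absurd _ _ _ X Y xy) | exact: (absurd _ _ _ Y Z yz)
            | exact: (absurd _ _ _ X Z xz)].
- exact: triangle_case_fixed e3 X Y Z.
- exact: triangle_case_transposed e3 X Z Y.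
- exact: triangle_case_transposed rr3 Z Y X.
- exact: triangle_case_cyclic e3 X Y Z.
- exact: triangle_case_cyclic (eigen_triple_swap e3) X Z Y.
- exact: triangle_case_transposed r3 Y X Z.
Qed.

(** * Coincidences among the roots of the characteristic polynomial *)

Lemma rank_product_eq0 (B C : 'M[K]_3) : B * C = 0 ->
  (\rank B <= 1)%N || (\rank C <= 1)%N.
Proof.
(* The ranks of the two factors add up to at most 3. *)
move=> /mulmx0_rank_max; apply: contraLR; rewrite negb_or -!ltnNge => /andP[rB
  rC].
by apply: leq_trans (leq_add rB rC).
Qed.

Lemma exists_eigenvalues : exists x y z : K,
  [/\ (A - x%:M) * (A - y%:M) * (A - z%:M) = 0,
      eigenvalue A x, eigenvalue A y & eigenvalue A z].
Proof.
have [r] := closed_field_poly_normal (char_poly A).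
rewrite (monicP (char_poly_monic A)) scale1r => defP.
have := size_char_poly A; rewrite defP size_prod_XsubC => -[].
case: r defP => [|x [|y [|z [|? ?]]]] //= defP _; exists x, y, z.
split; last 1 first.
- by rewrite eigenvalue_root_char defP root_prod_XsubC !inE eqxx !orbT.
- have := Cayley_Hamilton A; rewrite defP !big_cons big_nil mulr1 !rmorphM /=.
  by rewrite !rmorphB /= !horner_mx_X !horner_mx_C mulrA.
- by rewrite eigenvalue_root_char defP root_prod_XsubC !inE eqxx.
by rewrite eigenvalue_root_char defP root_prod_XsubC !inE eqxx !orbT.
Qed.

Lemma shifts_commute (a b : K) :
  (A - a%:M) * (A - b%:M) = (A - b%:M) * (A - a%:M).
Proof.
rewrite -!mulmxE !mulmxBl !mulmxBr !mul_scalar_mx !mul_mx_scalar.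
rewrite !scale_scalar_mx !opprB [LHS]addrACA [RHS]addrACA mulrC.
by congr (_ + _); rewrite addrC.
Qed.

Lemma double_eigenvalue_case (x y : K) : x != y -> eigenvalue A y ->
    (A - x%:M) * (A - x%:M) * (A - y%:M) = 0 ->
  [\/ case_A iota q M sigma, case_C iota p q M sigma | case_E iota p q M sigma].
Proof.
move=> xy /eigenvalueP[w wA w0] E.
have comm := shifts_commute x y.
have [xy0|xyN0] := eqVneq ((A - x%:M) * (A - y%:M)) 0.
  by case/orP: (rank_product_eq0 xy0) => /perspectivity_case[];
     [constructor 1 | constructor 2 | constructor 1 | constructor 2].
have [i ri] := exists_row_neq0 xyN0.
move: ri; rewrite comm rowE -mulmxE mulmxA.
(* A nonzero row of the product starts a Jordan chain of length two for [x]. *)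
set t := delta_mx 0 i *m (A - y%:M) => u0; constructor 3.
apply: (@simple_jordan_case x y t (t *m (A - x%:M)) w) => //.
- by rewrite mulmxBr mul_mx_scalar addrC subrK.
have: t *m (A - x%:M) *m (A - x%:M) = 0.
  by rewrite /t -!mulmxA !mulmxE mulrA -comm -mulrA -comm mulrA E mulmx0.
by rewrite mulmxBr mul_mx_scalar => /eqP; rewrite subr_eq0 => /eqP.
Qed.

Lemma similitude_classification :
  case_A iota q M sigma \/ case_B iota p q M sigma \/ case_C iota p q M sigma \/
  case_D iota p q M sigma \/ case_E iota p q M sigma.
Proof.
have [x [y [z [E ex ey ez]]]] := exists_eigenvalues.
have commN := shifts_commute.
have double a b : a != b -> eigenvalue A b ->
    (A - a%:M) * (A - a%:M) * (A - b%:M) = 0 ->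
    case_A iota q M sigma \/ case_B iota p q M sigma \/ case_C iota p q M sigma
      \/
    case_D iota p q M sigma \/ case_E iota p q M sigma.
  by move=> ab eb /(double_eigenvalue_case ab eb)[]; tauto.
have [xy|xy] := eqVneq x y.
  rewrite -{y ey}xy in E; have [xz|xz] := eqVneq x z; last exact: double xz ez
    E.
  rewrite -{z ez}xz in E.
  (* For a triple root, a shift with zero square has rank at most 1; otherwise there is a single
     Jordan block. *)
  have [N2|N2] := eqVneq ((A - x%:M) * (A - x%:M)) 0.
    by have := rank_product_eq0 N2; rewrite orbb => /perspectivity_case[];
      tauto.
  by do 3 right; left; apply: (@full_jordan_case x); rewrite // !exprS expr0
    mulr1 // mulrA.
have [yz|yz] := eqVneq y z.
  rewrite -{z ez}yz in E; apply: (double y x) => //; first by rewrite eq_sym.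
  by rewrite -E -mulrA (commN y x) mulrA (commN y x).
have [xz|xz] := eqVneq x z.
  rewrite -{z ez yz}xz in E; apply: (double x y) => //.
  by rewrite -E -mulrA (commN x y) mulrA (commN x y).
have [[u uA u0] [v vA v0] [w wA w0]] := And3 (eigenvalueP ex) (eigenvalueP ey)
  (eigenvalueP ez).
by right; left; apply: (@triangle_case x y z u v w).
Qed.

End HermitianForm.

Theorem lemma2p2 (p n q : nat) (F : finFieldType) (K : closedFieldType)
    (iota : {rmorphism F -> K}) (M : {'GL_3[F]}) (sigma : PGL3 F) :
  prime p -> (1 <= n)%N -> q = (p ^ n)%N -> #|F| = (q ^ 2)%N ->
  integralRange iota ->
  in_PGU3 iota q M sigma -> sigma != 1%g ->
  case_A iota q M sigma \/
  case_B iota p q M sigma \/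
  case_C iota p q M sigma \/
  case_D iota p q M sigma \/
  case_E iota p q M sigma.
Proof.
move=> p_pr n_gt0 defq cardF _ sigmaH sigma_neq1.
have [c hA] := collineation_similitude p_pr n_gt0 defq cardF sigmaH.
exact: (similitude_classification p_pr n_gt0 defq cardF sigma_neq1 hA).
Qed.
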